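(* Under Assumptions 1 and 2 (stated in the context), the closure of $\mathcal{K}_\beta$ in $\mathbb{R}^{m\times n}$ is $$\operatorname{cl}(\mathcal{K}_\beta)=\{K\in\mathcal{K}:\|\mathbf{T}_\infty(K)\|_{\mathcal{H}_\infty}\le\beta\}.$$
   Context: Let $A\in\mathbb{R}^{n\times n}$, $B\in\mathbb{R}^{n\times m}$, $B_w\in\mathbb{R}^{n\times n}$, $W:=B_wB_w^{\mathsf T}$. Let $Q_2\succeq0$, $R_2\succ0$, $Q_\infty\succ0$, $R_\infty\succ0$ be symmetric weight matrices and $\beta>0$. For $K\in\mathbb{R}^{m\times n}$ write $A_K:=A+BK$. Let $\mathcal{K}:=\{K: A_K \text{ Hurwitz}\}$. For $K\in\mathcal{K}$ let $\mathbf{T}_\infty(K)(s)=\begin{bmatrix}Q_\infty^{1/2}\\ R_\infty^{1/2}K\end{bmatrix}(sI-A_K)^{-1}B_w$ and $\|\cdot\|_{\mathcal{H}_\infty}$ the $\mathcal{H}_\infty$ norm. $\mathcal{K}_\beta:=\{K\in\mathcal{K}:\|\mathbf{T}_\infty(K)\|_{\mathcal{H}_\infty}<\beta\}$. Assumption 1: $(A,B)$ stabilizable, $(Q_2^{1/2},A)$ detectable, and $\beta>\beta^\ast:=\inf_{K\in\mathcal{K}}\|\mathbf{T}_\infty(K)\|_{\mathcal{H}_\infty}$. Assumption 2: $Q_2\succeq0$ and $W,Q_\infty,R_2,R_\infty$ positive definite. *)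

(* Defs.v *)
From HB Require Import structures.
From mathcomp Require Import all_boot all_order all_algebra.
From mathcomp Require Import all_classical all_reals all_analysis.
From mathcomp Require Import complex.
Set Implicit Arguments. Unset Strict Implicit. Unset Printing Implicit Defensive.
Import Order.TTheory GRing.Theory Num.Theory.
Local Open Scope ring_scope.
Local Open Scope classical_set_scope.

Section LQRHinf.
Variable R : realType.

Definition Cmx (p q : nat) (M : 'M[R]_(p, q)) : 'M[R[i]]_(p, q) :=
  map_mx (fun x => Complex x 0) M.

Definition hurwitz (n : nat) (A : 'M[R]_n) : Prop :=
  forall s : R[i], eigenvalue (Cmx A) s -> complex.Re s < 0.

Definition AK (n m : nat) (A : 'M[R]_n) (B : 'M[R]_(n, m)) (K : 'M[R]_(m, n))
  : 'M[R]_n := A + B *m K.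

Definition Kstab (n m : nat) (A : 'M[R]_n) (B : 'M[R]_(n, m)) :
  set 'M[R]_(m, n) := [set K | hurwitz (AK A B K)].

Definition cvnorm (k : nat) (v : 'cV[R[i]]_k) : R :=
  Num.sqrt (\sum_(i < k) (complex.Re (v i 0) ^+ 2 + complex.Im (v i 0) ^+ 2)).

Definition opnorm (p q : nat) (M : 'M[R[i]]_(p, q)) : R :=
  sup [set cvnorm (M *m v) | v in [set v : 'cV[R[i]]_q | cvnorm v = 1]].

(* T_inf(K)(i w) = [Qinf^{1/2}; Rinf^{1/2} K] (i w I - A_K)^{-1} B_w *)
Definition Tinf (n m : nat) (A : 'M[R]_n) (B : 'M[R]_(n, m)) (Bw : 'M[R]_n)
  (Qinfh : 'M[R]_n) (Rinfh : 'M[R]_m) (K : 'M[R]_(m, n)) (w : R)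
  : 'M[R[i]]_(n + m, n) :=
  Cmx (col_mx Qinfh (Rinfh *m K))
    *m invmx ((Complex 0 w)%:M - Cmx (AK A B K)) *m Cmx Bw.

Definition hinf_norm (n m : nat) (A : 'M[R]_n) (B : 'M[R]_(n, m)) (Bw : 'M[R]_n)
  (Qinfh : 'M[R]_n) (Rinfh : 'M[R]_m) (K : 'M[R]_(m, n)) : R :=
  sup (range (fun w : R => opnorm (Tinf A B Bw Qinfh Rinfh K w))).

Definition Kbeta (n m : nat) (A : 'M[R]_n) (B : 'M[R]_(n, m)) (Bw : 'M[R]_n)
  (Qinfh : 'M[R]_n) (Rinfh : 'M[R]_m) (beta : R) : set 'M[R]_(m, n) :=
  [set K | Kstab A B K /\ hinf_norm A B Bw Qinfh Rinfh K < beta].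

Definition beta_star (n m : nat) (A : 'M[R]_n) (B : 'M[R]_(n, m)) (Bw : 'M[R]_n)
  (Qinfh : 'M[R]_n) (Rinfh : 'M[R]_m) : R :=
  inf [set hinf_norm A B Bw Qinfh Rinfh K | K in Kstab A B].

Definition stabilizable (n m : nat) (A : 'M[R]_n) (B : 'M[R]_(n, m)) : Prop :=
  exists K : 'M[R]_(m, n), hurwitz (A + B *m K).

Definition detectable (p n : nat) (C : 'M[R]_(p, n)) (A : 'M[R]_n) : Prop :=
  exists L : 'M[R]_(n, p), hurwitz (A + L *m C).

Definition psd (n : nat) (M : 'M[R]_n) : Prop :=
  M^T = M /\ forall v : 'cV[R]_n, 0 <= (v^T *m M *m v) 0 0.

Definition pd (n : nat) (M : 'M[R]_n) : Prop :=
  M^T = M /\ forall v : 'cV[R]_n, v != 0 -> 0 < (v^T *m M *m v) 0 0.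

Definition is_sqrtm (n : nat) (S M : 'M[R]_n) : Prop := psd S /\ S *m S = M.

End LQRHinf.

(* Main.v *)
Require Import Defs.
From HB Require Import structures.
From mathcomp Require Import all_boot all_order all_algebra.
From mathcomp Require Import all_classical all_reals all_analysis.
From mathcomp Require Import complex mxred spectral sesquilinear.
From mathcomp Require Import ring lra.
Set Implicit Arguments. Unset Strict Implicit. Unset Printing Implicit Defensive.
Import Order.TTheory GRing.Theory Num.Theory numFieldNormedType.Exports.
Local Open Scope ring_scope.
Local Open Scope classical_set_scope.

(* The bounded real lemma and convexity of its inequality in the variables
   X = P^-1, Y = K X.

   Call K dissipative at level c if x^T P (A_K x + Bw u) + |C_K x|^2 <= c |u|^2
   for all x, u and some P > 0.  In the frequency domain this gives stability
   and |C_K x|^2 <= c |u|^2 whenever s x = A_K x + Bw u with Re s >= 0.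
   Conversely a stabilising K of norm < sqrt c is dissipative at level c: if no
   symmetric P works, separating a compact convex set of positive semidefinite
   matrices from 0 yields Z >= 0 with F Z E^T + E Z F^T = 0 and tr (Q Z) >= 0,
   and Z splits into complex rank-one terms z z^* with F z = i w E z or E z = 0,
   each violating the frequency inequality; P > 0 is Lyapunov's theorem.

   Inclusion from left to right: absorbing B (K' - K) x into the disturbance
   (Bw is invertible) turns dissipativity of K' in K_beta into an inequality
   for A_K on the closed right half plane which is continuous in K'; in the limit
   it gives stability of K and the norm bound.

   Inclusion from right to left: if |T(K)| <= beta then K is dissipative at a level
   slightly above beta^2, and some K0 strictly below beta^2.  A convex
   combination in (X, Y) with small weight on K0 is dissipative strictly below
   beta^2.  Invertibility of Bw bounds P uniformly near the level beta^2, so the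
   combined controllers tend to K. *)

(** * Real quadratic forms *)

Section Dot.
Variable R : realType.
Implicit Types k l : nat.

Definition dot k (u v : 'cV[R]_k) : R := (u^T *m v) 0 0.

Lemma dotE k (u v : 'cV[R]_k) : dot u v = \sum_i u i 0 * v i 0.
Proof. by rewrite /dot mxE; apply: eq_bigr => i _; rewrite mxE. Qed.

Lemma dotC k (u v : 'cV[R]_k) : dot u v = dot v u.
Proof. by rewrite !dotE; apply: eq_bigr => i _; rewrite mulrC. Qed.

Lemma dotDl k (u v w : 'cV[R]_k) : dot (u + v) w = dot u w + dot v w.
Proof. by rewrite /dot linearD /= mulmxDl mxE. Qed.

Lemma dotDr k (u v w : 'cV[R]_k) : dot w (u + v) = dot w u + dot w v.
Proof. by rewrite /dot mulmxDr mxE. Qed.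

Lemma dotZl k a (u w : 'cV[R]_k) : dot (a *: u) w = a * dot u w.
Proof. by rewrite /dot linearZ /= -scalemxAl mxE. Qed.

Lemma dotZr k a (u w : 'cV[R]_k) : dot w (a *: u) = a * dot w u.
Proof. by rewrite dotC dotZl dotC. Qed.

Lemma dotNl k (u w : 'cV[R]_k) : dot (- u) w = - dot u w.
Proof. by rewrite -scaleN1r dotZl mulN1r. Qed.

Lemma dotNr k (u w : 'cV[R]_k) : dot w (- u) = - dot w u.
Proof. by rewrite dotC dotNl dotC. Qed.

Lemma dot0l k (w : 'cV[R]_k) : dot 0 w = 0.
Proof. by rewrite -(scale0r 0) dotZl mul0r. Qed.

Lemma dot0r k (w : 'cV[R]_k) : dot w 0 = 0.
Proof. by rewrite dotC dot0l. Qed.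

Lemma dot_mulmxl k l (M : 'M[R]_(k, l)) u v :
  dot (M *m u) v = dot u (M^T *m v).
Proof. by rewrite /dot trmx_mul mulmxA. Qed.

Lemma dot_sym k (P : 'M[R]_k) (u v : 'cV[R]_k) :
  P^T = P -> dot u (P *m v) = dot v (P *m u).
Proof. by move=> Ps; rewrite dotC dot_mulmxl Ps. Qed.

Lemma dot_ge0 k (u : 'cV[R]_k) : 0 <= dot u u.
Proof. by rewrite dotE sumr_ge0 // => i _; rewrite -expr2 sqr_ge0. Qed.

Lemma dot_eq0 k (u : 'cV[R]_k) : (dot u u == 0) = (u == 0).
Proof.
apply/eqP/eqP => [|->]; last by rewrite dot0l.
rewrite dotE => /eqP; rewrite psumr_eq0 => [/allP u0|i _]; last first.
  by rewrite -expr2 sqr_ge0.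
apply/colP => i; rewrite mxE; have := u0 i (mem_index_enum i).
by rewrite mulf_eq0 orbb => /eqP.
Qed.

Lemma dot_gt0 k (u : 'cV[R]_k) : (0 < dot u u) = (u != 0).
Proof. by rewrite lt_def dot_eq0 dot_ge0 andbT. Qed.

Lemma dot_col_mx k l (u u' : 'cV[R]_k) (v v' : 'cV[R]_l) :
  dot (col_mx u v) (col_mx u' v') = dot u u' + dot v v'.
Proof. by rewrite /dot tr_col_mx mul_row_col mxE. Qed.

Lemma psdE k (M : 'M[R]_k) :
  psd M <-> M^T = M /\ forall v, 0 <= dot v (M *m v).
Proof. by rewrite /psd /dot; split => -[? H]; split=> // v; have := H v; rewrite mulmxA. Qed.

Lemma pdE k (M : 'M[R]_k) :
  pd M <-> M^T = M /\ forall v, v != 0 -> 0 < dot v (M *m v).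
Proof.
by rewrite /pd /dot; split => -[? H]; split=> // v vn0; have := H v vn0; rewrite mulmxA.
Qed.

End Dot.

(** * Semidefinite alternative *)

Section Alternative.
Variable R : realType.

Lemma continuous_sum (T : topologicalType) (I : finType) (f : I -> T -> R) :
  (forall i, continuous (f i)) -> continuous (fun x => \sum_i f i x).
Proof.
move=> fc; have -> : (fun x => \sum_i f i x) = \sum_i f i.
  by apply/funext => x; rewrite fct_sumE.
apply: (big_ind (fun g : T -> R => continuous g)) => //.
- by move=> x; apply: cvg_cst.
- by move=> g h gc hc x; apply: cvgD; [exact: gc|exact: hc].
Qed.

(** Let [c] minimise the squared norm of [h] on [D]. Minimality along the segment from [h c] to
    [h v] makes the inner product of [h c] with [h v - h c] nonnegative, so the nonzero vector [h c]
    is itself a separating functional. *)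
Lemma separation (T : topologicalType) (I : finType) (D : set T)
    (h : T -> I -> R) :
  D !=set0 -> compact D -> (forall i, continuous (h^~ i)) ->
  (forall u v t, D u -> D v -> 0 <= t <= 1 ->
     exists2 w, D w & forall i, h w i = (1 - t) * h u i + t * h v i) ->
  (forall u, D u -> exists i, h u i != 0) ->
  exists a : I -> R, forall v, D v -> 0 < \sum_i a i * h v i.
Proof.
move=> D0 Dc hc Dconv hn0; pose f u := \sum_i h u i * h u i.
have fc : continuous f.
  by apply: continuous_sum => i u; apply: cvgM; exact: hc.
have [c /set_mem Dc0 cmin] := compact_EVT_min D0 Dc (continuous_subspaceT fc).
exists (h c) => v Dv.
pose S := \sum_i h c i * h c i; pose X := \sum_i h c i * (h v i - h c i).
pose Y := \sum_i (h v i - h c i) * (h v i - h c i).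
have -> : \sum_i h c i * h v i = S + X.
  by rewrite /S /X -big_split /=; apply: eq_bigr => i _; ring.
have S0 : 0 < S.
  have [i hi] := hn0 _ Dc0; rewrite lt_def; apply/andP; split.
    rewrite psumr_neq0; last by move=> j _; rewrite -expr2 sqr_ge0.
    apply/hasP; exists i; first exact: mem_index_enum.
    by rewrite /= -expr2 exprn_even_gt0.
  by apply: sumr_ge0 => j _; rewrite -expr2 sqr_ge0.
have Y0 : 0 <= Y by apply: sumr_ge0 => j _; rewrite -expr2 sqr_ge0.
suff : 0 <= X by lra.
have XY t : 0 <= t <= 1 -> 0 <= 2 * t * X + t * t * Y.
  move=> t01; have [w Dw hw] := Dconv _ _ _ Dc0 Dv t01.
  have := cmin w (mem_set Dw); rewrite /f.
  have -> : \sum_i h w i * h w i = S + (2 * t * X + t * t * Y).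
    rewrite /S /X /Y !mulr_sumr -!big_split /=.
    by apply: eq_bigr => i _; rewrite hw; ring.
  by rewrite -/S; lra.
rewrite leNgt; apply/negP => X0.
have YX : 0 < Y - X by lra.
(* Here 2tX + t^2 Y = tX(1 + t) < 0. Unlike the exact minimiser -X/Y, this value is defined for Y =
   0 and never exceeds 1. *)
pose t := - X / (Y - X).
have tE : t * (Y - X) = - X by rewrite /t divfK // gt_eqF.
have t0 : 0 < t by rewrite /t divr_gt0 // oppr_gt0.
have t1 : t <= 1 by rewrite /t ler_pdivrMr //; lra.
have := XY t; rewrite (ltW t0) t1 => /(_ isT).
nra.
Qed.

Lemma linear_mx_continuous p q (g : 'M[R]_(p, q) -> R) :
  (forall a u v, g (a *: u + v) = a * g u + g v) -> continuous g.
Proof.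
move=> glin.
have g0 : g 0 = 0.
  by have := glin 1 0 0; rewrite scale1r addr0 mul1r; lra.
have gZ a u : g (a *: u) = a * g u by rewrite -[a *: u]addr0 glin g0 addr0.
have gD u v : g (u + v) = g u + g v by rewrite -[u]scale1r glin mul1r scale1r.
have -> : g = fun v => \sum_(ij : 'I_p * 'I_q)
    v ij.1 ij.2 * g (delta_mx ij.1 ij.2).
  apply/funext => v; rewrite {1}[v]matrix_sum_delta pair_bigA /=.
  by rewrite (big_morph g gD g0); apply: eq_bigr => j _; rewrite gZ.
have /= := @continuous_sum ('M[R]_(p, q) : topologicalType) ('I_p * 'I_q)%type
  (fun ij v => v ij.1 ij.2 * g (delta_mx ij.1 ij.2)).
apply=> -[i j] v /=.
have vij_cont := @coord_continuous R p q i j v.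
have := continuousM vij_cont (@cst_continuous _ _ (g (delta_mx i j)) v).
exact.
Qed.

Lemma closed_linear_le N (g : 'rV[R]_N -> R) c :
  (forall a u v, g (a *: u + v) = a * g u + g v) -> closed [set v | g v <= c].
Proof.
move=> glin; apply: (@preimage_closed _ _ g [set x : R | x <= c]).
  by move=> v _; exact: linear_mx_continuous.
exact: closed_le.
Qed.

Lemma psd_diag_ge0 k (Z : 'M[R]_k) i : psd Z -> 0 <= Z i i.
Proof.
move=> [_ /(_ (delta_mx i 0))]; rewrite trmx_delta -rowE -colE.
by rewrite !mxE.
Qed.

Lemma psd_diag_le_tr k (Z : 'M[R]_k) i : psd Z -> Z i i <= \tr Z.
Proof.
move=> Zp; rewrite /mxtrace (bigD1 i) //= lerDl.
by apply: sumr_ge0 => j _; exact: psd_diag_ge0.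
Qed.

(** The form is nonnegative at the sum and at the difference of two basis vectors, which bounds 2|Z
    i j| by Z i i + Z j j. *)
Lemma psd_entry_le k (Z : 'M[R]_k) i j : psd Z -> `|Z i j| <= \tr Z.
Proof.
move=> Zp; have /psdE[Zs Zge0] := Zp.
have dotd a b : dot (delta_mx a 0) (Z *m delta_mx b 0) = Z a b.
  by rewrite /dot trmx_delta -rowE -colE !mxE.
have Zji : Z j i = Z i j by rewrite -{1}Zs mxE.
have H (c : R) : 0 <= Z i i + 2 * c * Z i j + c * c * Z j j.
  have := Zge0 (delta_mx i 0 + c *: delta_mx j 0).
  rewrite mulmxDr -scalemxAr !(dotDl, dotDr, dotZl, dotZr) !dotd Zji; lra.
have := psd_diag_le_tr i Zp; have := psd_diag_le_tr j Zp.
by have := H 1; have := H (-1); rewrite ler_norml => *; apply/andP; split; lra.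
Qed.

Lemma psd_outer k (z : 'cV[R]_k) : psd (z *m z^T).
Proof.
apply/psdE; split; first by rewrite trmx_mul trmxK.
move=> v; rewrite -mulmxA dotC dot_mulmxl /dot.
by rewrite (_ : (z^T *m v)^T = (z^T *m v)) ?mxE ?big_ord1 -?expr2 ?sqr_ge0 //
  [_ *m v]mx11_scalar tr_scalar_mx.
Qed.

(** Entries are bounded by the trace, and the set is an intersection of closed half-spaces. Asking
    for trace at most 1, not equal to 1, keeps 0 in the set; its value fixes the sign of a
    multiplier in [sdp_alternative]. *)
Lemma psd_compact k :
  compact [set v : 'rV[R]_(k * k) | psd (vec_mx v) /\ \tr (vec_mx v) <= 1].
Proof.
apply: bounded_closed_compact.
  exists 1; split=> [|M M1 v [vp vtr]]; first exact: num_real.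
  rewrite /= /Num.norm /= mx_normrE; apply/bigmax_leP; split; first lra.
  move=> [i j] _ /=; rewrite ord1 -(vec_mxK v).
  case/mxvec_indexP: j => a b; rewrite mxvecE.
  by rewrite (le_trans (psd_entry_le _ _ vp))// (le_trans vtr)// ltW.
have -> : [set v : 'rV[R]_(k * k) | psd (vec_mx v) /\ \tr (vec_mx v) <= 1] =
    (\bigcap_(ij in [set: 'I_k * 'I_k])
       [set v | vec_mx v ij.2 ij.1 - vec_mx v ij.1 ij.2 <= 0]) `&`
    (\bigcap_(x in [set: 'cV[R]_k]) [set v | 0 <= dot x (vec_mx v *m x)]) `&`
    [set v | \tr (vec_mx v) <= 1].
  apply/seteqP; split => v /=.
    move=> [/psdE[vs vp] vt]; split=> //; split=> [[i j] _ /=|x _ /=]; last exact: vp.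
    by rewrite -{1}vs [_^T _ _]mxE subrr.
  move=> [[vs vp] vt]; split=> //; apply/psdE; split; last by move=> x; exact: vp.
  apply/matrixP => i j; rewrite mxE; apply/eqP; rewrite eq_le.
  by have := vs (i, j) I; have := vs (j, i) I; rewrite /= !subr_le0 => -> ->.
apply: closedI; first apply: closedI.
- apply: closed_bigI => -[i j] _ /=.
  by apply: closed_linear_le => a u v; rewrite linearP /= !mxE; ring.
- apply: closed_bigI => x _ /=.
  rewrite (_ : mkset _ = [set v | - dot x (vec_mx v *m x) <= 0]).
    apply: closed_linear_le => a u v.
    by rewrite linearP /= mulmxDl -scalemxAl dotDr dotZr; ring.
  by apply/seteqP; split=> v /=; rewrite oppr_le0.
- apply: closed_linear_le => a u v.
  by rewrite linearP /= mxtraceD mxtraceZ.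
Qed.

Lemma psd_convex k (Z Z' : 'M[R]_k) t : 0 <= t <= 1 -> psd Z -> psd Z' ->
  psd ((1 - t) *: Z + t *: Z').
Proof.
move=> /andP[t0 t1] /psdE[Zs Zp] /psdE[Zs' Zp']; apply/psdE; split.
  by rewrite linearD /= !linearZ /= Zs Zs'.
move=> v; rewrite mulmxDl -!scalemxAl dotDr !dotZr.
by apply: addr_ge0; apply: mulr_ge0 => //; lra.
Qed.

Lemma sum_entries_mul n (p : 'M[R]_n) (x y : 'cV[R]_n) :
  \sum_(ij : 'I_n * 'I_n) p ij.1 ij.2 * (x *m y^T) ij.1 ij.2 = dot x (p *m y).
Proof.
rewrite dotE -(pair_bigA _ (fun i j => p i j * (x *m y^T) i j)) /=.
apply: eq_bigr => i _; rewrite mxE mulr_sumr; apply: eq_bigr => j _.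
by rewrite mxE big_ord1 mxE; ring.
Qed.

(** The affine map sending Z to FZE^T + EZF^T and tr(QZ) + tr Z - 1 has no zero on the compact
    convex set of [psd_compact]. The coefficients of a separating functional, symmetrised and
    rescaled, form [P]; rank-one Z give the inequality. *)
Lemma sdp_alternative (n k : nat) (E F : 'M[R]_(n, k)) (Q : 'M[R]_k) :
  (forall Z, psd Z -> Z != 0 -> F *m Z *m E^T + E *m Z *m F^T = 0 ->
     \tr (Q *m Z) < 0) ->
  exists2 P : 'M[R]_n, P^T = P &
    forall z, z != 0 -> dot (E *m z) (P *m (F *m z)) + dot z (Q *m z) < 0.
Proof.
move=> dual.
pose a (Z : 'M[R]_k) := F *m Z *m E^T + E *m Z *m F^T.
have aP t Z Z' : a (t *: Z + Z') = t *: a Z + a Z'.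
  rewrite /a !mulmxDr !mulmxDl -!scalemxAr -!scalemxAl scalerDr.
  by rewrite addrACA.
(* Where the [None] coordinate vanishes, tr(QZ) = 1 - tr Z >= 0, which [dual] forbids if the first
   block vanishes and Z is nonzero; at Z = 0 this coordinate is -1. *)
pose h (v : 'rV[R]_(k * k)) (i : option ('I_n * 'I_n)) :=
  if i is Some ij then a (vec_mx v) ij.1 ij.2
  else \tr (Q *m vec_mx v) + \tr (vec_mx v) - 1.
have [||||p p_gt0] := separation (h := h) _ (@psd_compact k).
- exists 0; rewrite /= linear0 mxtrace0; split; last lra.
  by apply/psdE; split=> [|v]; rewrite ?trmx0 // mul0mx dot0r.
- case=> [[i j]|] /=.
    by apply: linear_mx_continuous => t u v; rewrite /= linearP /= aP !mxE.
  have trc : continuous (fun v : 'rV[R]_(k * k) =>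
      \tr (Q *m vec_mx v) + \tr (vec_mx v)).
    apply: linear_mx_continuous => t u v.
    by rewrite linearP /= mulmxDr -scalemxAr !mxtraceD !mxtraceZ; ring.
  move=> v; have := continuousB (trc v) (@cst_continuous _ _ (1 : R) v).
  exact.
- move=> u v t [up ut] [vp vt] t01; exists ((1 - t) *: u + t *: v).
    rewrite /= linearD !linearZ /=; split; first exact: psd_convex.
    by rewrite mxtraceD !mxtraceZ; nra.
  case=> [[i j]|]; rewrite /h linearD !linearZ /=.
    by rewrite aP -[t *: vec_mx v]addr0 aP /a !(mulmx0, mul0mx, addr0) !mxE.
  by rewrite mulmxDr -!scalemxAr !mxtraceD !mxtraceZ; ring.
- move=> v [vp vt]; apply: contrapT => /forallNP h0.
  have {}h0 i : h v i = 0 by apply/eqP/negPn/negP; exact: h0.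
  have hN := h0 None; rewrite /= in hN.
  have [Z0|Z0] := eqVneq (vec_mx v) 0.
    by move: hN; rewrite Z0 mulmx0 mxtrace0; lra.
  have /(dual _ vp Z0) : a (vec_mx v) = 0.
    by apply/matrixP => i j; rewrite [RHS]mxE; exact: (h0 (Some (i, j))).
  by move: hN vt; lra.
have sumE v : \sum_i p i * h v i = p None * h v None +
    \sum_ij p (Some ij) * a (vec_mx v) ij.1 ij.2.
  rewrite (bigD1 None) //=; congr (_ + _).
  rewrite (reindex_omap Some id) //=; last by case.
  by apply: eq_bigl => i; rewrite eqxx.
pose c := p None.
(* At Z = 0 only the [None] coordinate survives, so the functional takes the value -c there. *)
have c0 : c < 0.
  have := p_gt0 0; rewrite sumE /= linear0 mxtrace0 mulmx0 mxtrace0.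
  rewrite big1 => [|ij _]; last by rewrite /a !(mulmx0, mul0mx, addr0) mxE mulr0.
  have psd0 : psd (0 : 'M[R]_k).
    by apply/psdE; split=> [|v]; rewrite ?trmx0 // mul0mx dot0r.
  by move=> /(_ (conj psd0 ler01)); rewrite -/c; lra.
pose q : 'M[R]_n := \matrix_(i, j) p (Some (i, j)).
exists (c^-1 *: (q^T + q)).
  by rewrite linearZ /= linearD /= trmxK addrC.
move=> z z0; have zz : 0 < dot z z by rewrite dot_gt0.
pose s := (dot z z)^-1.
have s0 : 0 < s by rewrite invr_gt0.
have trzz (M : 'M[R]_k) : \tr (M *m (z *m z^T)) = dot z (M *m z).
  by rewrite mulmxA mxtrace_mulC /dot /mxtrace big_ord1.
(* Scaling by [s] gives trace 1, so that tr Z - 1 drops out; dividing by the negative [c] will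
   reverse the inequality. *)
have := p_gt0 (mxvec (s *: (z *m z^T))).
rewrite sumE /= mxvecK -scalemxAr !mxtraceZ trzz.
have -> : \tr (z *m z^T) = dot z z by rewrite -[z *m _]mul1mx trzz mul1mx.
have -> : s * dot z z = 1 by rewrite mulVf // gt_eqF.
have -> : \sum_ij p (Some ij) * a (s *: (z *m z^T)) ij.1 ij.2 =
   s * dot (E *m z) ((q^T + q) *m (F *m z)).
  have -> : a (s *: (z *m z^T)) =
      s *: ((F *m z) *m (E *m z)^T + (E *m z) *m (F *m z)^T).
    rewrite -[s *: _]addr0 aP /a !(mulmx0, mul0mx, addr0).
    by rewrite !trmx_mul !mulmxA.
  rewrite mulmxDl dotDr -dot_mulmxl dotC -!sum_entries_mul -big_split mulr_sumr /=.
  by apply: eq_bigr => -[i j] _; rewrite !mxE /=; ring.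
have -> : psd (s *: (z *m z^T)) <-> True.
  split=> // _; have /psdE[zs zp] := psd_outer z; apply/psdE; split.
    by rewrite linearZ /= zs.
  by move=> v; rewrite -scalemxAl dotZr mulr_ge0 // ltW.
move=> /(_ (conj I (lexx _))).
rewrite addrK -/c => H.
have : 0 < c * dot z (Q *m z) + dot (E *m z) ((q^T + q) *m (F *m z)).
  rewrite -(pmulr_rgt0 _ s0); nra.
rewrite -scalemxAl dotZr; set X := dot z _; set Y := dot _ _ => {}H.
have -> : c^-1 * Y + X = c^-1 * (c * X + Y).
  by field; rewrite lt_eqF.
by rewrite nmulr_rlt0 // invr_lt0.
Qed.

End Alternative.

(** * Skew-hermitian pairs *)

Section Adjoint.
Variable C : numClosedFieldType.
Local Open Scope sesquilinear_scope.

Lemma adjmxM m n p (A : 'M[C]_(m, n)) (B : 'M[C]_(n, p)) :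
  (A *m B)^t* = B^t* *m A^t*.
Proof. by rewrite trmx_mul map_mxM. Qed.

Lemma adjmxD m n (A B : 'M[C]_(m, n)) : (A + B)^t* = A^t* + B^t*.
Proof. by rewrite linearD map_mxD. Qed.

Lemma adjmxN m n (A : 'M[C]_(m, n)) : (- A)^t* = - A^t*.
Proof. by rewrite linearN map_mxN. Qed.

Lemma mulmx_adj_eq0 m n (D : 'M[C]_(m, n)) : D *m D^t* = 0 -> D = 0.
Proof.
move=> /matrixP DD; apply/matrixP => i j; rewrite mxE.
have := DD i i; rewrite !mxE => /eqP; rewrite psumr_eq0 => [/allP H|l _].
  have := H j (mem_index_enum j); rewrite !mxE.
  by rewrite mul_conjC_eq0 => /eqP.
by rewrite !mxE mul_conjC_ge0.
Qed.

(** Both [pinvmx T] and its adjoint are generalised inverses of the hermitian T = X X^*, hence so is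
    their mean [G]. Then D = TGX - X satisfies D D^* = 0, so D = 0. *)
Lemma gram_hermitian_ginv n k (X : 'M[C]_(n, k)) :
  exists2 G : 'M[C]_n, G^t* = G & X *m X^t* *m G *m X = X.
Proof.
have [T TE] : exists T, T = X *m X^t* by exists (X *m X^t*).
rewrite -TE; pose g := pinvmx T.
have Th : T^t* = T by rewrite TE adjmxM trmxCK.
have TgT : T *m g *m T = T by rewrite mulmxKpV.
have TgT' : T *m g^t* *m T = T.
  by have := congr1 (fun M => M^t*) TgT; rewrite /= !adjmxM Th mulmxA.
pose G := 2^-1 *: (g + g^t*).
have Gh : G^t* = G.
  rewrite /G linearZ map_mxZ /= adjmxD trmxCK addrC.
  by rewrite fmorphV rmorph_nat.
have TGT : T *m G *m T = T.
  rewrite /G -scalemxAr -scalemxAl mulmxDr mulmxDl TgT TgT'.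
  by rewrite -mulr2n -[T *+ 2]scaler_nat scalerA mulVf ?scale1r // pnatr_eq0.
exists G => //; apply/eqP; rewrite -subr_eq0; apply/eqP.
apply: mulmx_adj_eq0; set D := _ - X.
have DX : D *m X^t* = 0 by rewrite mulmxBl -!mulmxA -TE !mulmxA TGT subrr.
by rewrite {2}/D adjmxD adjmxN !adjmxM mulmxBr !mulmxA DX !mul0mx subrr.
Qed.

(* The projection [X^* G X] onto the row space of [X] commutes with the
   skew-hermitian matrix [X^* G S G X] representing [Y] on that space, so that
   both are diagonalised by the same unitary matrix. *)
Lemma skew_pair_decomposition n k (X Y : 'M[C]_(n, k)) :
  Y *m X^t* + X *m Y^t* = 0 ->
  exists2 V : 'M[C]_k, V *m V^t* = 1%:M &
    forall j, X *m col j V = 0 \/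
      exists2 mu, mu^* = - mu & Y *m col j V = mu *: (X *m col j V).
Proof.
move=> YX; have [G Gh TGX] := gram_hermitian_ginv X.
have [S SE] : exists S, S = Y *m X^t* by exists (Y *m X^t*).
have SN : S = - (X *m Y^t*) by apply/eqP; rewrite SE -addr_eq0 YX.
have Sh : S^t* = - S by rewrite {2}SN opprK SE adjmxM trmxCK.
have TGS : X *m X^t* *m G *m S = S by rewrite SN mulmxN mulmxA TGX.
have SGT : S *m G *m (X *m X^t*) = S.
  have := congr1 (fun M => M^t*) TGS; rewrite /= !adjmxM trmxCK Gh Sh !mulNmx.
  by move=> H; rewrite -mulmxA; exact: (oppr_inj H).
pose Pi := X^t* *m G *m X; pose Om := X^t* *m G *m S *m G *m X.
have Pih : Pi^t* = Pi by rewrite /Pi !adjmxM trmxCK Gh mulmxA.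
have Omh : Om^t* = - Om.
  by rewrite /Om !adjmxM trmxCK Gh Sh !(mulmxN, mulNmx) !mulmxA.
have XPi : X *m Pi = X by rewrite /Pi !mulmxA.
have YPi : Y *m Pi = X *m Om by rewrite /Pi /Om !mulmxA -SE TGS.
have PiOm : Pi *m Om = Om.
  by rewrite {2}/Om /Pi -[X in _ = X *m _ *m _]mulmxA -TGS /Om !mulmxA.
have OmPi : Om *m Pi = Om.
  by rewrite /Om /Pi -{2}SGT !mulmxA.
(* Commuting hermitian and skew-hermitian matrices add up to a normal matrix. A unitary eigenbasis
   of [N] serves both, since each is half of N + N^* or N - N^*. *)
pose N := Pi + Om.
have Nh : N^t* = Pi - Om by rewrite /N adjmxD Pih Omh.
have Nnormal : N \is normalmx.
  apply/normalmxP; rewrite Nh /N !(mulmxDl, mulmxDr, mulmxN, mulNmx) PiOm OmPi.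
  by rewrite !addrA subrK addrK.
pose P := spectralmx N; pose sp := spectral_diag N.
have Pu : P \is unitarymx by exact: spectral_unitarymx.
have NE : N = P^t* *m diag_mx sp *m P.
  by move/orthomx_spectralP: Nnormal; rewrite invmx_unitary.
have PP : P *m P^t* = 1%:M by exact/unitarymxP.
exists (P^t*).
  by rewrite trmxCK; exact: mulmx1C.
move=> j; set v := col j _.
have diagv (d : 'rV[C]_k) : P^t* *m diag_mx d *m P *m v = d 0 j *: v.
  rewrite /v colE -!mulmxA [P *m _]mulmxA PP mul1mx scalemxAr; congr (_ *m _).
  apply/matrixP => a b; rewrite mul_diag_mx !mxE.
  by case: eqP => [->|_] //=; rewrite !mulr0.
have Nv : N *m v = sp 0 j *: v by rewrite {1}NE diagv.
have Nhv : N^t* *m v = (sp 0 j)^* *: v.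
  rewrite NE !adjmxM trmxCK mulmxA tr_diag_mx map_diag_mx diagv.
  by rewrite mxE.
have N2 : 2 *: Pi = N + N^t*.
  by rewrite Nh /N addrACA subrr addr0 scaler_nat mulr2n.
have N3 : 2 *: Om = N - N^t*.
  by rewrite Nh /N opprB addrC addrA subrK scaler_nat mulr2n.
pose r := sp 0 j + (sp 0 j)^*; pose q := sp 0 j - (sp 0 j)^*.
have Piv : 2 *: (Pi *m v) = r *: v.
  by rewrite scalemxAl N2 mulmxDl Nv Nhv scalerDl.
have Omv : 2 *: (Om *m v) = q *: v.
  by rewrite scalemxAl N3 mulmxBl Nv Nhv scalerBl.
have two0 : (2 : C) != 0 by rewrite pnatr_eq0.
(* r/2 is the eigenvalue of [Pi] at v. If it is 0 then X v = X Pi v = 0; otherwise r Y v = 2 Y Pi v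
   = 2 X Om v = q X v. *)
have [r0|r0] := eqVneq r 0.
  left; apply: (scalerI two0).
  by rewrite -{1}XPi -mulmxA scalemxAr Piv r0 scale0r mulmx0 scaler0.
right; exists (q / r).
  rewrite rmorphM fmorphV /r /q !(rmorphD, rmorphB) /=.
  by rewrite rmorphN /= conjCK [(sp 0 j)^* + sp 0 j]addrC -mulNr opprB.
apply: (scalerI r0); rewrite scalerA mulrC divfK //.
by rewrite scalemxAr -Piv -scalemxAr mulmxA YPi -mulmxA scalemxAr Omv scalemxAr.
Qed.

End Adjoint.

(** * Kalman-Yakubovich-Popov lemma *)

Section ComplexParts.
Variable R : realType.
Local Open Scope sesquilinear_scope.
Local Notation C := R[i].

(** * Real and imaginary parts of complex matrices *)

Definition remx k l (z : 'M[C]_(k, l)) : 'M[R]_(k, l) := map_mx (@complex.Re R) z.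
Definition immx k l (z : 'M[C]_(k, l)) : 'M[R]_(k, l) := map_mx (@complex.Im R) z.

Lemma conjCE (z : C) : z^* = Complex (complex.Re z) (- complex.Im z).
Proof. by case: z. Qed.

Lemma Re_sum (I : finType) (f : I -> C) :
  complex.Re (\sum_i f i) = \sum_i complex.Re (f i).
Proof. by apply: (big_morph (@complex.Re R)) => // -[a b] [c d]. Qed.

Lemma Im_sum (I : finType) (f : I -> C) :
  complex.Im (\sum_i f i) = \sum_i complex.Im (f i).
Proof. by apply: (big_morph (@complex.Im R)) => // -[a b] [c d]. Qed.

Lemma Re_mul (x y : C) : complex.Re (x * y) =
  complex.Re x * complex.Re y - complex.Im x * complex.Im y.
Proof. by case: x y => [a b] [c d]. Qed.

Lemma Im_mul (x y : C) : complex.Im (x * y) =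
  complex.Re x * complex.Im y + complex.Im x * complex.Re y.
Proof. by case: x y => [a b] [c d]. Qed.

Lemma remx_mul k l m (A : 'M[C]_(k, l)) (B : 'M[C]_(l, m)) :
  remx (A *m B) = remx A *m remx B - immx A *m immx B.
Proof.
apply/matrixP => i j; rewrite !mxE Re_sum -sumrB; apply: eq_bigr => r _.
by rewrite !mxE Re_mul.
Qed.

Lemma immx_mul k l m (A : 'M[C]_(k, l)) (B : 'M[C]_(l, m)) :
  immx (A *m B) = remx A *m immx B + immx A *m remx B.
Proof.
apply/matrixP => i j; rewrite !mxE Im_sum -big_split /=; apply: eq_bigr => r _.
by rewrite !mxE Im_mul.
Qed.

Lemma remx_Cmx k l (A : 'M[R]_(k, l)) : remx (Cmx A) = A.
Proof. by apply/matrixP => i j; rewrite !mxE. Qed.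

Lemma immx_Cmx k l (A : 'M[R]_(k, l)) : immx (Cmx A) = 0.
Proof. by apply/matrixP => i j; rewrite !mxE. Qed.

Lemma remx_CmxM k l m (A : 'M[R]_(k, l)) (B : 'M[C]_(l, m)) :
  remx (Cmx A *m B) = A *m remx B.
Proof. by rewrite remx_mul remx_Cmx immx_Cmx mul0mx subr0. Qed.

Lemma immx_CmxM k l m (A : 'M[R]_(k, l)) (B : 'M[C]_(l, m)) :
  immx (Cmx A *m B) = A *m immx B.
Proof. by rewrite immx_mul remx_Cmx immx_Cmx mul0mx addr0. Qed.

Lemma remxZ k l s (B : 'M[C]_(k, l)) :
  remx (s *: B) = complex.Re s *: remx B - complex.Im s *: immx B.
Proof. by apply/matrixP => i j; rewrite !mxE Re_mul. Qed.

Lemma immxZ k l s (B : 'M[C]_(k, l)) :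
  immx (s *: B) = complex.Re s *: immx B + complex.Im s *: remx B.
Proof. by apply/matrixP => i j; rewrite !mxE Im_mul. Qed.

Lemma remx_adj k l (A : 'M[C]_(k, l)) : remx (A^t*) = (remx A)^T.
Proof. by apply/matrixP => i j; rewrite !mxE conjCE. Qed.

Lemma immx_adj k l (A : 'M[C]_(k, l)) : immx (A^t*) = - (immx A)^T.
Proof. by apply/matrixP => i j; rewrite !mxE conjCE. Qed.

Lemma parts_inj k l (A B : 'M[C]_(k, l)) :
  remx A = remx B -> immx A = immx B -> A = B.
Proof.
move=> /matrixP r /matrixP i; apply/matrixP => a b.
have := r a b; have := i a b; rewrite !mxE.
by case: (A a b) (B a b) => [x y] [x' y'] /= -> ->.
Qed.

Lemma remx0 k l : remx (0 : 'M[C]_(k, l)) = 0.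
Proof. by apply/matrixP => i j; rewrite !mxE. Qed.

Lemma immx0 k l : immx (0 : 'M[C]_(k, l)) = 0.
Proof. by apply/matrixP => i j; rewrite !mxE. Qed.

Lemma CmxM k l m (A : 'M[R]_(k, l)) (B : 'M[R]_(l, m)) :
  Cmx (A *m B) = Cmx A *m Cmx B.
Proof.
apply: parts_inj; first by rewrite remx_CmxM !remx_Cmx.
by rewrite immx_CmxM !immx_Cmx mulmx0.
Qed.

Lemma CmxD k l (A B : 'M[R]_(k, l)) : Cmx (A + B) = Cmx A + Cmx B.
Proof. by apply/matrixP => i j; rewrite !mxE; congr Complex; rewrite addr0. Qed.

Lemma Cmx_adj k l (A : 'M[R]_(k, l)) : (Cmx A)^t* = Cmx A^T.
Proof. by apply/matrixP => i j; rewrite !mxE conjCE oppr0. Qed.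

Lemma Cmx_tr k l (A : 'M[R]_(k, l)) : (Cmx A)^T = Cmx A^T.
Proof. by apply/matrixP => i j; rewrite !mxE. Qed.

Lemma Cmx0 k l : Cmx (0 : 'M[R]_(k, l)) = 0.
Proof. by apply/matrixP => i j; rewrite !mxE. Qed.

Lemma Cmx_inj k l : injective (@Cmx R k l).
Proof. by move=> A B AB; rewrite -[A]remx_Cmx AB remx_Cmx. Qed.

Lemma parts_eq0 k (z : 'cV[C]_k) :
  (dot (remx z) (remx z) + dot (immx z) (immx z) == 0) = (z == 0).
Proof.
rewrite paddr_eq0 ?dot_ge0 // !dot_eq0; apply/andP/eqP => [[/eqP r /eqP i]|->].
  by apply: parts_inj; rewrite ?remx0 ?immx0.
by rewrite remx0 immx0 eqxx.
Qed.

Lemma quad_sym k (N : 'M[R]_k) (u : 'rV[C]_k) : N^T = N ->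
  (u *m Cmx N *m u^t*) 0 0 =
  Complex (dot (remx u)^T (N *m (remx u)^T) + dot (immx u)^T (N *m (immx u)^T)) 0.
Proof.
move=> Ns; set x := _ 0 0.
have -> : x = Complex (remx (u *m Cmx N *m u^t*) 0 0) (immx (u *m Cmx N *m u^t*) 0 0).
  by rewrite /x !mxE; case: (\sum_j _).
rewrite -mulmxA remx_mul [immx (u *m _)]immx_mul remx_CmxM immx_CmxM.
rewrite remx_adj immx_adj.
rewrite !mulmxN opprK; congr Complex.
  by rewrite mxE /dot !trmxK.
rewrite mxE [X in X + _]mxE.
have := dot_sym (remx u)^T (immx u)^T Ns; rewrite /dot !trmxK => ->.
by rewrite addNr.
Qed.

(** Each eigenvalue is the value of the form at a row of the diagonalising matrix, hence a sum of
    two real nonnegative values; scale the eigenvectors by the square roots. *)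
Lemma psd_factor k (Z : 'M[R]_k) : psd Z ->
  exists G : 'M[C]_k, G *m G^t* = Cmx Z.
Proof.
move=> /psdE[Zs Zp].
have Zn : Cmx Z \is normalmx by apply/normalmxP; rewrite Cmx_adj Zs.
pose P := spectralmx (Cmx Z); pose d := spectral_diag (Cmx Z).
have Pu : P \is unitarymx by exact: spectral_unitarymx.
have PP : P *m P^t* = 1%:M by exact/unitarymxP.
have ZE : Cmx Z = P^t* *m diag_mx d *m P.
  by move/orthomx_spectralP: Zn; rewrite invmx_unitary.
have d_ge0 i : 0 <= d 0 i.
  have -> : d 0 i = (row i P *m Cmx Z *m (row i P)^t*) 0 0.
    rewrite ZE rowE adjmxM !mulmxA -(mulmxA _ P) PP mulmx1.
    rewrite -(mulmxA _ P) PP mulmx1 trmx_delta.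
    have -> : map_mx Num.conj (delta_mx i 0) = delta_mx i 0 :> 'cV[C]_k.
      by apply/matrixP => a b; rewrite !mxE rmorph_nat.
    by rewrite -rowE -colE !mxE eqxx.
  by rewrite quad_sym // lecE /= eqxx addr_ge0.
pose e : 'rV[C]_k := \row_i sqrtC (d 0 i).
exists (P^t* *m diag_mx e); rewrite adjmxM trmxCK mulmxA -(mulmxA _ (diag_mx e)).
rewrite tr_diag_mx map_diag_mx ZE; congr (_ *m _ *m _).
apply/matrixP => i j; rewrite mul_diag_mx !mxE.
case: eqP => [->|_]; last by rewrite !mulr0.
by rewrite !mulr1n /= geC0_conj ?sqrtC_ge0 // -expr2 sqrtCK.
Qed.

Lemma tr_gram k m (Q : 'M[R]_k) (A : 'M[R]_(k, m)) :
  \tr (Q *m (A *m A^T)) = \sum_j dot (col j A) (Q *m col j A).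
Proof.
rewrite mulmxA mxtrace_mulC; apply: eq_bigr => j _.
have -> : Q *m col j A = col j (Q *m A) by rewrite !colE mulmxA.
by rewrite dotE mxE; apply: eq_bigr => i _; rewrite !mxE.
Qed.

(** With Z = G G^*, [skew_pair_decomposition] for E G and F G rotates the columns of G until each
    meets one of the two frequency conditions. Then tr(QZ) is a sum of terms that the hypothesis
    makes negative. *)
Lemma kyp (n k : nat) (E F : 'M[R]_(n, k)) (Q : 'M[R]_k) :
  (forall z : 'cV[C]_k, z != 0 ->
     (Cmx E *m z = 0 \/ exists w, Cmx F *m z = Complex 0 w *: (Cmx E *m z)) ->
     dot (remx z) (Q *m remx z) + dot (immx z) (Q *m immx z) < 0) ->
  exists2 P : 'M[R]_n, P^T = P &
    forall z, z != 0 -> dot (E *m z) (P *m (F *m z)) + dot z (Q *m z) < 0.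
Proof.
move=> Hz; apply: sdp_alternative => Z Zp Z0 FZE.
have [G GG] := psd_factor Zp.
have [|V VV colV] := @skew_pair_decomposition _ n k (Cmx E *m G) (Cmx F *m G).
  rewrite !adjmxM !mulmxA -!(mulmxA _ G) GG !Cmx_adj -!CmxM -CmxD FZE.
  exact: Cmx0.
pose H := G *m V.
have HH : H *m H^t* = Cmx Z by rewrite /H adjmxM mulmxA -(mulmxA G) VV mulmx1.
have -> : Z = remx H *m (remx H)^T + immx H *m (immx H)^T.
  rewrite -[LHS]remx_Cmx -HH remx_mul remx_adj immx_adj mulmxN opprK //.
rewrite mulmxDr mxtraceD !tr_gram -big_split /=.
pose f j := dot (col j (remx H)) (Q *m col j (remx H)) +
  dot (col j (immx H)) (Q *m col j (immx H)).
have fneg j : col j H != 0 -> f j < 0.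
  move=> cj; have := Hz _ cj; rewrite /remx /immx !map_col; apply.
  have [c0|[mu muh c0]] := colV j.
    by left; rewrite -c0 /H !colE !mulmxA.
  (* [mu] is purely imaginary, so its imaginary part is the frequency. *)
  right; exists (complex.Im mu).
  have -> : Complex 0 (complex.Im mu) = mu.
    have := congr1 (@complex.Re R) muh; rewrite conjCE; case: (mu) => a b /= ab.
    by have -> : a = 0 by lra.
  by move: c0; rewrite /H !colE !mulmxA.
have [j cj] : exists j, col j H != 0.
  apply: contrapT => /forallNP c0.
  have H0 : H = 0.
    apply/matrixP => i j; have /negP/negPn/eqP/colP/(_ i) := c0 j.
    by rewrite !mxE.
  by move: Z0; rewrite -[Z]remx_Cmx -HH H0 mul0mx remx0 eqxx.
rewrite (bigD1 j) //= -/(f j).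
have : \sum_(i | i != j) f i <= 0.
  apply: sumr_le0 => i _; have [ci|/fneg/ltW//] := eqVneq (col i H) 0.
  rewrite /f /remx /immx -!map_col ci -/(remx _) -/(immx _) remx0 immx0.
  by rewrite !mulmx0 dot0r addr0.
have := fneg j cj; rewrite /f; lra.
Qed.

End ComplexParts.

(** * Lyapunov's theorem *)

Section Triangular.
Variable C : numClosedFieldType.
Local Open Scope sesquilinear_scope.

Lemma lyapunov_formE n m (T P : 'M[C]_n) (y : 'M[C]_(m, n)) : P^t* = P ->
  y *m (T *m P + P *m T^t*) *m y^t* =
  y *m T *m (y *m P)^t* + y *m P *m (y *m T)^t*.
Proof. by move=> Ph; rewrite !adjmxM Ph mulmxDr mulmxDl !mulmxA. Qed.

Lemma adj_row_mx m n1 n2 (A : 'M[C]_(m, n1)) (B : 'M[C]_(m, n2)) :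
  (row_mx A B)^t* = col_mx (A^t*) (B^t*).
Proof. by rewrite tr_row_mx map_col_mx. Qed.

Lemma adj0 m n : (0 : 'M[C]_(m, n))^t* = 0.
Proof. by rewrite trmx0 map_mx0. Qed.

(** Lyapunov's theorem for a lower triangular matrix, made a predicate so that the induction step
    can assume it for all pairs of smaller size. *)
Definition lyapunov_positive n (T P : 'M[C]_n) :=
  is_trig_mx T -> (forall i, T i i + (T i i)^* < 0) -> P^t* = P ->
  (forall y : 'rV_n, y != 0 -> (y *m (T *m P + P *m T^t*) *m y^t*) 0 0 < 0) ->
  forall y : 'rV_n, y != 0 -> 0 < (y *m P *m y^t*) 0 0.

(* The first basis vector is invariant under [T]; split off its
   [P]-orthogonal complement, on which [P] acts as the Schur complement. *)
Lemma lyapunov_positive_block n (T P : 'M[C]_(1 + n)) :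
  (forall T' P' : 'M[C]_n, lyapunov_positive T' P') -> lyapunov_positive T P.
Proof.
move=> IH Ttrig Tdiag Ph TP y y0.
pose p := ulsubmx P; pose r := dlsubmx P.
have PE : P = block_mx p (r^t*) r (drsubmx P).
  rewrite -[LHS]submxK; congr block_mx.
  by rewrite /r -{1}Ph -map_ursubmx -trmx_dlsub.
have ph : p^t* = p by rewrite /p -{2}Ph -map_ulsubmx -trmx_ulsub.
pose l := ulsubmx T; pose T' := drsubmx T.
have TE : T = block_mx l 0 (dlsubmx T) T'.
  rewrite -[LHS]submxK; congr block_mx.
  apply/matrixP => i j; rewrite !mxE; apply: (is_trig_mxP Ttrig).
  by rewrite /= ord1 ltn_addr.
have p_gt0 : 0 < p 0 0.
  (* At the first basis vector the Lyapunov form is 2 Re(l) p, and Re(l) < 0 forces p > 0. *)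
  have /TP : row_mx (1%:M : 'M[C]_1) (0 : 'rV_n) != 0.
    by rewrite row_mx_eq0 negb_and -[1%:M]/(1 : 'M[C]_1) oner_eq0.
  rewrite lyapunov_formE // PE TE !mul_row_block !mul1mx !mul0mx !addr0.
  rewrite !adj_row_mx !mul_row_col ph adj0 mulmx0 mul0mx !addr0.
  have p00 : (p 0 0)^* = p 0 0 by rewrite -{2}ph !mxE.
  rewrite {1 2}[p]mx11_scalar mul_mx_scalar mul_scalar_mx.
  have -> : (p 0 0 *: l + p 0 0 *: l^t*) 0 0 = (l 0 0 + (l 0 0)^*) * p 0 0.
    by rewrite !mxE -mulrDr mulrC.
  rewrite nmulr_rlt0 //.
  by have := Tdiag (lshift n 0); rewrite TE block_mxEul.
have p_unit : p \in unitmx.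
  by rewrite unitmxE det_mx11 unitfE gt_eqF.
pose s := drsubmx P - r *m invmx p *m r^t*.
have sh : s^t* = s.
  have -> : s = drsubmx P + - (r *m invmx p *m r^t*) by [].
  rewrite adjmxD adjmxN !adjmxM trmxCK mulmxA.
  have -> : (invmx p)^t* = invmx p by rewrite trmx_inv map_invmx ph.
  by have -> : (drsubmx P)^t* = drsubmx P
    by rewrite -{2}Ph -map_drsubmx -trmx_drsub.
(* The rows of [K] span the [P]-orthogonal complement of the first basis vector. On it [P] restricts
   to [s], and [T] acts as [T'] modulo that vector. *)
pose K := row_mx (- (r *m invmx p)) (1%:M : 'M[C]_n).
have KP : K *m P = row_mx 0 s.
  rewrite PE /K mul_row_block !mul1mx !mulNmx -mulmxA mulVmx // mulmx1 addNr.
  by rewrite [X in row_mx _ X]addrC.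
have KT : K *m T = row_mx (- (r *m invmx p) *m l + dlsubmx T) T'.
  by rewrite {1}TE /K mul_row_block !mul1mx mulmx0 add0r.
have s_gt0 (w : 'rV_n) : w != 0 -> 0 < (w *m s *m w^t*) 0 0.
  apply: (IH T' s) => //.
  - apply/is_trig_mxP => i j ij; rewrite !mxE.
    by apply: (is_trig_mxP Ttrig); rewrite /= ltn_add2l.
  - by move=> i; rewrite !mxE; exact: Tdiag.
  - move=> {}w w0; have /TP : w *m K != 0.
      apply: contra_neq w0; rewrite /K mul_mx_row mulmx1 => /eqP.
      by rewrite row_mx_eq0 => /andP[_ /eqP].
    rewrite !lyapunov_formE // -!(mulmxA w) KP KT !mul_mx_row mulmx0.
    by rewrite !adj_row_mx !mul_row_col adj0 mulmx0 mul0mx !add0r.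
pose c := lsubmx y; pose w := rsubmx y.
have [a aE] : exists a, a = c + w *m r *m invmx p by eexists.
have yE : y = row_mx a 0 + w *m K.
  rewrite /K mul_mx_row mulmx1 add_row_mx add0r mulmxN aE mulmxA addrK.
  by rewrite hsubmxK.
have -> : y *m P *m y^t* = a *m p *m a^t* + w *m s *m w^t*.
  have wKP : w *m K *m P = row_mx 0 (w *m s).
    by rewrite -mulmxA KP mul_mx_row mulmx0.
  have PKw : P *m (w *m K)^t* = col_mx 0 ((w *m s)^t*).
    by rewrite -{1}Ph -adjmxM wKP adj_row_mx adj0.
  rewrite yE adjmxD mulmxDl mulmxDr !mulmxDl wKP adj_row_mx adj0.
  rewrite -[row_mx a 0 *m P *m (w *m K)^t*]mulmxA PKw !mul_row_col.
  rewrite !(mulmx0, mul0mx, addr0, add0r) PE mul_row_block mul0mx !addr0.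
  rewrite mul_row_col mulmx0 addr0; congr (_ + _).
  by rewrite /K mul_mx_row mulmx1 adj_row_mx mul_row_col mul0mx add0r.
have apE : (a *m p *m a^t*) 0 0 = p 0 0 * (a 0 0 * (a 0 0)^*).
  by rewrite {1}[p]mx11_scalar mul_mx_scalar -scalemxAl !mxE big_ord1 !mxE.
rewrite mxE apE.
have [w0|w0] := eqVneq w 0.
  rewrite w0 !mul0mx [X in _ + X]mxE addr0 pmulr_rgt0 // mul_conjC_gt0.
  apply: contra_neq y0 => a0; rewrite yE w0 mul0mx addr0.
  by rewrite [a]mx11_scalar a0 raddf0 row_mx0.
by apply: ltr_wpDl (s_gt0 _ w0); rewrite mulr_ge0 ?mul_conjC_ge0 ?ltW.
Qed.

Lemma lyapunov_trig n (T P : 'M[C]_n) : lyapunov_positive T P.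
Proof.
elim: n => [|n IH] in T P *; last exact: lyapunov_positive_block.
by move=> _ _ _ _ y; rewrite [y]thinmx0 eqxx.
Qed.

End Triangular.

Section Lyapunov.
Variable R : realType.
Local Open Scope sesquilinear_scope.
Local Notation C := R[i].

Lemma hurwitz_unitmx n (A : 'M[R]_n) (s : C) : hurwitz A ->
  0 <= complex.Re s -> s%:M - Cmx A \in unitmx.
Proof.
move=> Ah s0; rewrite unitmxE unitfE; apply/det0P => -[v v0].
rewrite mulmxBr mul_mx_scalar => /eqP; rewrite subr_eq0 eq_sym => /eqP vA.
by have := Ah s (introT eigenvalueP (ex_intro2 _ _ v vA v0)); lra.
Qed.

(** A unitary change of basis makes the transpose of [A] triangular. It preserves definiteness of
    both [P] and the Lyapunov form, so [lyapunov_trig] applies. *)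
Lemma lyapunov_pd n (A P : 'M[R]_n) : hurwitz A -> P^T = P ->
  (forall x, x != 0 -> dot x (P *m (A *m x)) < 0) -> pd P.
Proof.
move=> Ah Ps PA; apply/pdE; split=> //.
have [|U Uu /andP[Ut _]] := @cotrigonalization _ n [:: (Cmx A)^T].
  by move=> M N; rewrite !inE => /eqP-> /eqP->.
have UU : U *m U^t* = 1%:M by exact/unitarymxP.
have UU' : U^t* *m U = 1%:M by exact: mulmx1C.
have [T TE] : exists T, T = U *m (Cmx A)^T *m U^t* by eexists.
have Ttrig : is_trig_mx T.
  by move: Ut; rewrite /= /similar_to /= conjumx ?unitarymx_unit // invmx_unitary // -TE.
have UTU : U^t* *m T *m U = (Cmx A)^T.
  by rewrite TE !mulmxA UU' mul1mx -mulmxA UU' mulmx1.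
have Tdiag i : T i i + (T i i)^* < 0.
  suff : complex.Re (T i i) < 0.
    rewrite conjCE; case: (T i i) => a b /= a0.
    by rewrite ltcE /= subrr eqxx /=; lra.
  (* Otherwise T i i - A would be invertible, although its triangular form has a zero on the
     diagonal. *)
  rewrite ltNge; apply/negP => /(hurwitz_unitmx Ah).
  rewrite -unitmx_tr linearB /= tr_scalar_mx -UTU unitmxE unitfE.
  have -> : (T i i)%:M - U^t* *m T *m U = U^t* *m ((T i i)%:M - T) *m U.
    by rewrite mulmxBr mulmxBl mul_mx_scalar -scalemxAl UU' scalemx1.
  have Dt : is_trig_mx ((T i i)%:M - T).
    apply/is_trig_mxP => a b ab; rewrite !mxE (is_trig_mxP Ttrig a b ab) subr0.
    by rewrite -val_eqE ltn_eqF.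
  rewrite !det_mulmx (det_trig Dt) (bigD1 i) //= !mxE eqxx mulr1n subrr.
  by rewrite mul0r mulr0 mul0r eqxx.
pose N := A^T *m P + P *m A.
have Ns : N^T = N by rewrite /N linearD /= !trmx_mul trmxK Ps addrC.
have Nneg x : x != 0 -> dot x (N *m x) < 0.
  move=> x0; have := PA x x0.
  have -> : dot x (N *m x) = 2 * dot x (P *m (A *m x)).
    rewrite /N mulmxDl dotDr -!mulmxA -dot_mulmxl (dot_sym _ _ Ps); ring.
  lra.
pose P2 := U *m Cmx P *m U^t*.
have P2h : P2^t* = P2 by rewrite /P2 !adjmxM trmxCK Cmx_adj Ps mulmxA.
have parts (u : 'rV[C]_n) : u != 0 -> (remx u)^T != 0 \/ (immx u)^T != 0.
  move=> u0; have [r0|] := eqVneq (remx u)^T 0; last by left.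
  right; apply: contra_neq u0 => i0; apply: parts_inj.
    by rewrite remx0 -[remx u]trmxK r0 trmx0.
  by rewrite immx0 -[immx u]trmxK i0 trmx0.
have TP2 : T *m P2 + P2 *m T^t* = U *m Cmx N *m U^t*.
  rewrite /P2 TE !adjmxM trmxCK -[(Cmx A)^T^t*]/(((Cmx A)^T)^t*) Cmx_tr Cmx_adj.
  rewrite trmxK !mulmxA -2!(mulmxA _ (U^t*) U) UU' !mulmx1.
  by rewrite /N CmxD !CmxM mulmxDr mulmxDl !mulmxA.
have P2_gt0 := @lyapunov_trig _ n T P2 Ttrig Tdiag P2h _.
move=> v v0; pose u : 'rV[C]_n := (Cmx v)^T.
have -> : dot v (P *m v) = complex.Re ((u *m U^t* *m P2 *m (u *m U^t*)^t*) 0 0).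
  rewrite /P2 adjmxM trmxCK !mulmxA -2!(mulmxA _ (U^t*) U) UU' !mulmx1.
  rewrite quad_sym //= /u Cmx_tr remx_Cmx immx_Cmx trmxK trmx0 dot0l addr0 //.
suff : 0 < (u *m U^t* *m P2 *m (u *m U^t*)^t*) 0 0 by rewrite ltcE => /andP[].
apply: P2_gt0 => [y y0|].
  rewrite TP2 !mulmxA -mulmxA -adjmxM quad_sym //.
  have /parts yU : y *m U != 0.
    by apply: contra_neq y0 => yU; rewrite -[y]mulmx1 -UU mulmxA yU mul0mx.
  have Nle x : dot x (N *m x) <= 0.
    by have [->|/Nneg/ltW//] := eqVneq x 0; rewrite dot0l.
  rewrite ltcE /= eqxx /=.
  have := Nle (remx (y *m U))^T; have := Nle (immx (y *m U))^T.
  by case: yU => /Nneg; lra.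
apply: contra_neq v0 => uU; have u0 : u = 0.
  by rewrite -[u]mulmx1 -UU' mulmxA uU mul0mx.
by apply: (@Cmx_inj R); rewrite Cmx0 -[LHS]trmxK -/u u0 trmx0.
Qed.

End Lyapunov.


(** * Operator norms *)

Section Norms.
Variable R : realType.
Local Notation C := R[i].

Lemma psd_cauchy_schwarz k (P : 'M[R]_k) (u v : 'cV[R]_k) : psd P ->
  dot u (P *m v) ^+ 2 <= dot u (P *m u) * dot v (P *m v).
Proof.
move=> /psdE[Ps Pp]; set a := dot u (P *m u); set b := dot v (P *m v).
set c := dot u (P *m v).
have H t : 0 <= a + 2 * t * c + t * t * b.
  have := Pp (u + t *: v).
  rewrite mulmxDr -scalemxAr !(dotDl, dotDr, dotZl, dotZr) (dot_sym v u Ps).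
  by rewrite -/a -/b -/c; lra.
have b0 : 0 <= b by exact: Pp.
have [b1|b1] := eqVneq b 0.
  have [c0|c0] := eqVneq c 0; first by rewrite b1 c0 expr0n mulr0.
  (* For b = 0 the polynomial is affine in t, and this t gives it the value -1. *)
  have := H (- (a + 1) / (2 * c)).
  have -> : 2 * (- (a + 1) / (2 * c)) * c = - (a + 1) by field.
  by rewrite b1 mulr0; lra.
have {b0 b1} b0 : 0 < b by rewrite lt_def b1.
have := H (- c / b).
have -> : a + 2 * (- c / b) * c + - c / b * (- c / b) * b = (a * b - c ^+ 2) / b.
  by field; rewrite gt_eqF.
by rewrite pmulr_lge0 ?invr_gt0 // subr_ge0.
Qed.

Lemma psd1 k : psd (1%:M : 'M[R]_k).
Proof. by apply/psdE; split=> [|v]; rewrite ?trmx1 // mul1mx dot_ge0. Qed.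

Lemma cauchy_schwarz k (u v : 'cV[R]_k) : dot u v ^+ 2 <= dot u u * dot v v.
Proof. by have := psd_cauchy_schwarz u v (psd1 k); rewrite !mul1mx. Qed.

Lemma mulmx_bounded k l (M : 'M[R]_(k, l)) :
  exists2 c, 0 <= c & forall x, dot (M *m x) (M *m x) <= c * dot x x.
Proof.
exists (\sum_i dot (row i M)^T (row i M)^T).
  by apply: sumr_ge0 => i _; exact: dot_ge0.
move=> x; rewrite [leLHS]dotE mulr_suml; apply: ler_sum => i _.
have -> : (M *m x) i 0 = dot (row i M)^T x.
  by rewrite /dot trmxK -row_mul [RHS]mxE.
by rewrite -expr2 cauchy_schwarz.
Qed.

Lemma dot_convex k (a b : 'cV[R]_k) e : 0 <= e <= 1 ->
  dot ((1 - e) *: a + e *: b) ((1 - e) *: a + e *: b) <=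
  (1 - e) * dot a a + e * dot b b.
Proof.
move=> /andP[e0 e1]; have e1' : 0 <= 1 - e by rewrite subr_ge0.
have := mulr_ge0 (mulr_ge0 e0 e1') (dot_ge0 (a - b)).
rewrite !(dotDl, dotDr, dotZl, dotZr, dotNl, dotNr) (dotC b a); lra.
Qed.

Lemma dot_subr_le k (a b : 'cV[R]_k) :
  dot (a - b) (a - b) <= 2 * dot a a + 2 * dot b b.
Proof.
have := dot_ge0 (a + b).
rewrite !(dotDl, dotDr, dotNl, dotNr) (dotC b a); lra.
Qed.

Lemma dot_addr_le k (a b : 'cV[R]_k) :
  dot (a + b) (a + b) <= 2 * dot a a + 2 * dot b b.
Proof.
have := dot_ge0 (a - b).
rewrite !(dotDl, dotDr, dotNl, dotNr) (dotC b a); lra.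
Qed.

Definition cvsq k (v : 'cV[C]_k) : R :=
  dot (remx v) (remx v) + dot (immx v) (immx v).

Lemma cvsq_ge0 k (v : 'cV[C]_k) : 0 <= cvsq v.
Proof. by rewrite addr_ge0 ?dot_ge0. Qed.

Lemma cvsq_eq0 k (v : 'cV[C]_k) : (cvsq v == 0) = (v == 0).
Proof. exact: parts_eq0. Qed.

Lemma cvnormE k (v : 'cV[C]_k) : cvnorm v = Num.sqrt (cvsq v).
Proof.
rewrite /cvnorm /cvsq !dotE -big_split /=; congr Num.sqrt.
by apply: eq_bigr => i _; rewrite !mxE !expr2.
Qed.

Lemma cvsqZ k (a : R) (v : 'cV[C]_k) : cvsq (Complex a 0 *: v) = a ^+ 2 * cvsq v.
Proof.
rewrite /cvsq remxZ immxZ /= !scale0r subr0 addr0 !dotZl !dotZr; ring.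
Qed.

Lemma cmulmx_bounded k l (M : 'M[C]_(k, l)) :
  exists2 c, 0 <= c & forall x, cvsq (M *m x) <= c * cvsq x.
Proof.
have [a a0 Ha] := mulmx_bounded (remx M).
have [b b0 Hb] := mulmx_bounded (immx M).
exists (2 * (a + b)); first by rewrite mulr_ge0 ?addr_ge0.
move=> x; rewrite /cvsq remx_mul immx_mul.
apply: (le_trans (lerD (dot_subr_le _ _) (dot_addr_le _ _))).
have := Ha (remx x); have := Hb (remx x).
have := Ha (immx x); have := Hb (immx x); lra.
Qed.

Lemma opnorm_ge0 k l (M : 'M[C]_(k, l)) : 0 <= opnorm M.
Proof.
rewrite /opnorm; set S := [set _ | _ in _].
(* [sup] is 0 for a set without supremum; this covers [l] = 0, where there are no unit vectors. *)
have [Ss|] := pselect (has_sup S); last by move=> /sup_out ->.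
have [[y Sy] _] := Ss; have := sup_upper_bound Ss Sy; apply: le_trans.
by case: Sy => v _ <-; rewrite cvnormE sqrtr_ge0.
Qed.

Lemma opnorm_bound k l (M : 'M[C]_(k, l)) v :
  cvsq (M *m v) <= opnorm M ^+ 2 * cvsq v.
Proof.
have [->|v0] := eqVneq v 0.
  by rewrite mulmx0 (eqP (_ : cvsq 0 == 0)) ?cvsq_eq0 // mulr_ge0 ?sqr_ge0 ?cvsq_ge0.
have v1 : 0 < cvsq v by rewrite lt_def cvsq_eq0 v0 cvsq_ge0.
pose a := (Num.sqrt (cvsq v))^-1; pose u := Complex a 0 *: v.
have a2 : a ^+ 2 * cvsq v = 1.
  by rewrite exprVn sqr_sqrtr ?cvsq_ge0 // mulVf // gt_eqF.
have : cvnorm (M *m u) <= opnorm M.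
  apply: ub_le_sup; last by exists u => //=; rewrite cvnormE cvsqZ a2 sqrtr1.
  have [c c0 Hc] := cmulmx_bounded M.
  exists (Num.sqrt c) => _ [w /= w1 <-]; rewrite cvnormE.
  apply: ler_wsqrtr; rewrite (le_trans (Hc w)) //.
  move: w1; rewrite cvnormE => /(congr1 (fun x => x ^+ 2)).
  by rewrite sqr_sqrtr ?cvsq_ge0 // expr1n => ->; rewrite mulr1.
rewrite cvnormE -(@ler_pXn2r _ 2) ?nnegrE ?sqrtr_ge0 ?opnorm_ge0 //.
rewrite sqr_sqrtr ?cvsq_ge0 // -scalemxAr cvsqZ => H.
have := ler_wpM2r (ltW v1) H; rewrite mulrAC a2 mul1r //.
Qed.

Lemma opnorm_le k l (M : 'M[C]_(k, l)) c : 0 <= c ->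
  (forall v, cvsq (M *m v) <= c ^+ 2 * cvsq v) -> opnorm M <= c.
Proof.
move=> c0 Hc; rewrite /opnorm; set S := [set _ | _ in _].
have [->|S0] := eqVneq S set0; first by rewrite sup0.
apply: ge_sup; first exact/set0P.
move=> _ [v /= v1 <-]; rewrite cvnormE -[c]ger0_norm // -sqrtr_sqr.
apply: ler_wsqrtr; rewrite (le_trans (Hc v)) //.
move: v1; rewrite cvnormE => /(congr1 (fun x => x ^+ 2)).
by rewrite sqr_sqrtr ?cvsq_ge0 // expr1n => ->; rewrite mulr1.
Qed.

End Norms.

(** * Bounded real lemma *)

Section Dissipation.
Variable R : realType.
Local Notation C := R[i].

Lemma remxD k l (a b : 'M[C]_(k, l)) : remx (a + b) = remx a + remx b.
Proof. by apply/matrixP => i j; rewrite !mxE; case: (a i j) (b i j) => ? ? []. Qed.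

Lemma immxD k l (a b : 'M[C]_(k, l)) : immx (a + b) = immx a + immx b.
Proof. by apply/matrixP => i j; rewrite !mxE; case: (a i j) (b i j) => ? ? []. Qed.

Lemma hurwitz_kernel n (A : 'M[R]_n) (s : C) (x : 'cV[C]_n) : hurwitz A ->
  0 <= complex.Re s -> Cmx A *m x = s *: x -> x = 0.
Proof.
move=> Ah s0 Ax; rewrite -[x](mulKmx (hurwitz_unitmx Ah s0)).
by rewrite mulmxBl mul_scalar_mx Ax subrr mulmx0.
Qed.

(** [eigenvalue] speaks of row eigenvectors; the determinant of the transpose turns them into
    columns. *)
Lemma hurwitzP n (A : 'M[R]_n) :
  (forall (s : C) (x : 'cV[C]_n), 0 <= complex.Re s -> Cmx A *m x = s *: x -> x = 0) ->
  hurwitz A.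
Proof.
move=> H s /eigenvalueP[v vA v0]; rewrite ltNge; apply/negP => s0.
have : \det ((s%:M - Cmx A)^T) = 0.
  rewrite det_tr; apply/eqP/det0P; exists v => //.
  by rewrite mulmxBr mul_mx_scalar vA subrr.
move/eqP/det0P => [w w0 wA]; have /(H s _ s0) : Cmx A *m w^T = s *: w^T.
  apply/eqP; rewrite eq_sym -subr_eq0 -mul_scalar_mx -mulmxBl.
  by rewrite -[X in X == _]trmxK trmx_mul trmxK wA trmx0.
by move/(congr1 trmx); rewrite trmxK trmx0 => /eqP; rewrite (negPf w0).
Qed.

(** Add the dissipation inequalities for the real and the imaginary parts: the terms in Im s cancel
    by symmetry of [P], and those in Re s are nonnegative. *)
Lemma dissipation_rhp n l p (A P : 'M[R]_n) (B : 'M[R]_(n, l))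
    (E : 'M[R]_(p, n)) c (s : C) x u :
  psd P ->
  (forall x u, dot x (P *m (A *m x + B *m u)) + dot (E *m x) (E *m x) <=
     c * dot u u) ->
  0 <= complex.Re s -> s *: x = Cmx A *m x + Cmx B *m u ->
  cvsq (Cmx E *m x) <= c * cvsq u.
Proof.
move=> /psdE[Ps Pp] diss s0 xu.
have := congr1 (@remx _ _ _) xu; have := congr1 (@immx _ _ _) xu.
rewrite remxZ immxZ remxD immxD !remx_CmxM !immx_CmxM => Hi Hr.
have := diss (remx x) (remx u); have := diss (immx x) (immx u).
rewrite -Hi -Hr /cvsq !remx_CmxM !immx_CmxM mulmxBr mulmxDr -!scalemxAr.
rewrite !(dotDr, dotNr, dotZr) (dot_sym (immx x) (remx x) Ps).
have := mulr_ge0 s0 (Pp (remx x)); have := mulr_ge0 s0 (Pp (immx x)).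
lra.
Qed.

(** For E = Q = 1 and F = A the hypothesis of [kyp] is vacuous, and it yields x^T P A x <= -|x|^2.
    On the imaginary axis the frequency cancels and |x|^2 <= |P B u|^2 remains, uniformly in w. *)
Lemma resolvent_bounded n l (A : 'M[R]_n) (B : 'M[R]_(n, l)) : hurwitz A ->
  exists2 c, 0 <= c & forall w x u,
    Complex 0 w *: x = Cmx A *m x + Cmx B *m u -> cvsq x <= c * cvsq u.
Proof.
move=> Ah.
have Cmx1 : Cmx 1%:M = 1%:M :> 'M[C]_n.
  by apply/matrixP => i j; rewrite !mxE; case: eqP.
have [|P Ps HP] := @kyp _ n n 1%:M A 1%:M.
  move=> z z0; rewrite Cmx1 mul1mx => -[/eqP|[w Aw]]; first by rewrite (negPf z0).
  by move: z0; rewrite (hurwitz_kernel Ah _ Aw) ?eqxx //=.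
have {}HP x : dot x (P *m (A *m x)) + dot x x <= 0.
  have [->|/HP/ltW] := eqVneq x 0; first by rewrite !dot0l addr0.
  by rewrite !mul1mx.
have [c c0 Hc] := mulmx_bounded (P *m B).
exists c => // w x u xu.
have := congr1 (@remx _ _ _) xu; have := congr1 (@immx _ _ _) xu.
rewrite remxZ immxZ remxD immxD !remx_CmxM !immx_CmxM /= !scale0r add0r sub0r.
move=> /eqP; rewrite -subr_eq => /eqP Hi /eqP; rewrite -subr_eq => /eqP Hr.
have := HP (remx x); have := HP (immx x); rewrite -Hr -Hi.
rewrite /cvsq !mulmxBr mulmxN -!scalemxAr !(dotDr, dotNr, dotZr) !mulmxA.
rewrite (dot_sym (immx x) (remx x) Ps).
have := dot_ge0 (remx x - P *m B *m remx u).
have := dot_ge0 (immx x - P *m B *m immx u).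
rewrite !(dotDl, dotDr, dotNl, dotNr) !(dotC (P *m B *m _)).
have := Hc (remx u); have := Hc (immx u); lra.
Qed.

(** This is [kyp] for the joint vector of state and input. The gap between [c0] and [c1] supplies
    strictness when u drives x at a frequency, and [c1] > 0 when x = 0; setting u = 0 leaves a
    Lyapunov inequality for [P]. *)
Lemma bounded_real n l p (A : 'M[R]_n) (B : 'M[R]_(n, l)) (E : 'M[R]_(p, n))
    (c0 c1 : R) :
  hurwitz A -> 0 < c1 -> c0 < c1 ->
  (forall w x u, Complex 0 w *: x = Cmx A *m x + Cmx B *m u ->
     cvsq (Cmx E *m x) <= c0 * cvsq u) ->
  exists2 P, pd P & forall x u,
    dot x (P *m (A *m x + B *m u)) + dot (E *m x) (E *m x) <= c1 * dot u u.
Proof.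
move=> Ah c1_gt0 c01 HE.
pose Q := block_mx (E^T *m E) 0 0 (- c1%:M : 'M[R]_l).
have QE (x : 'cV[R]_n) (u : 'cV[R]_l) :
    dot (col_mx x u) (Q *m col_mx x u) = dot (E *m x) (E *m x) - c1 * dot u u.
  rewrite /Q mul_block_col !mul0mx addr0 add0r mulNmx mul_scalar_mx dot_col_mx.
  by rewrite dotNr dotZr -mulmxA -dot_mulmxl.
have [|P Ps HP] := @kyp _ n (n + l) (row_mx 1%:M 0) (row_mx A B) Q.
  move=> z z0.
  pose x := usubmx z; pose u := dsubmx z.
  have zE : z = col_mx x u by rewrite vsubmxK.
  have rzE : remx z = col_mx (remx x) (remx u).
    by rewrite zE /remx map_col_mx.
  have izE : immx z = col_mx (immx x) (immx u).
    by rewrite zE /immx map_col_mx.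
  have Ez : Cmx (row_mx 1%:M 0) *m z = x.
    rewrite zE /Cmx map_row_mx mul_row_col -!/(Cmx _) Cmx0 mul0mx addr0.
    by apply: parts_inj; rewrite ?remx_CmxM ?immx_CmxM mul1mx.
  have Fz : Cmx (row_mx A B) *m z = Cmx A *m x + Cmx B *m u.
    by rewrite zE /Cmx map_row_mx mul_row_col.
  rewrite Ez Fz rzE izE !QE => H.
  suff : cvsq (Cmx E *m x) < c1 * cvsq u.
    by rewrite /cvsq !remx_CmxM !immx_CmxM; lra.
  (* With zero input, x would vanish too, since no iw is an eigenvalue of [A]. *)
  have u0 : u != 0.
    apply: contra_neq z0 => u0; rewrite zE u0.
    suff -> : x = 0 by rewrite col_mx0.
    case: H => [//|[w]]; rewrite u0 mulmx0 addr0.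
    by apply: (hurwitz_kernel Ah) => /=.
  have u1 : 0 < cvsq u by rewrite lt_def cvsq_eq0 u0 cvsq_ge0.
  case: H => [->|[w /esym/HE H]].
    rewrite mulmx0 (eqP (_ : cvsq 0 == 0)) ?cvsq_eq0 //; exact: mulr_gt0.
  by apply: (le_lt_trans H); rewrite ltr_pM2r.
have Ez (x : 'cV[R]_n) (u : 'cV[R]_l) : row_mx 1%:M 0 *m col_mx x u = x.
  by rewrite mul_row_col mul1mx mul0mx addr0.
exists P.
  apply: (lyapunov_pd Ah Ps) => x x0; have := HP (col_mx x 0).
  rewrite Ez QE mul_row_col mulmx0 addr0 dot0l mulr0 subr0 col_mx_eq0 negb_and x0.
  by move=> /(_ isT); have := dot_ge0 (E *m x); lra.
move=> x u; have [z0|/HP] := eqVneq (col_mx x u) 0.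
  move/eqP: z0; rewrite col_mx_eq0 => /andP[/eqP-> /eqP->].
  by rewrite !mulmx0 !dot0l mulr0 addr0.
by rewrite Ez QE mul_row_col; lra.
Qed.

End Dissipation.

(** * Dissipative controllers *)

Section Closure.
Variables (R : realType) (n m : nat) (A : 'M[R]_n) (B : 'M[R]_(n, m)).
Variables (Bw Qh : 'M[R]_n) (Rh : 'M[R]_m).
Implicit Types (K : 'M[R]_(m, n)) (P : 'M[R]_n).
Local Notation C := R[i].
Local Notation hinf := (hinf_norm A B Bw Qh Rh).
Local Notation out K := (col_mx Qh (Rh *m K)).

(** For symmetric [P] the first term is the derivative of the storage function x^T P x / 2 along the
    closed loop with disturbance u. *)
Definition dissipative K P c := forall x u : 'cV[R]_n,
  dot x (P *m (AK A B K *m x + Bw *m u)) + dot (out K *m x) (out K *m x)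
    <= c * dot u u.

Lemma Tinf_response K w (u : 'cV[C]_n) : hurwitz (AK A B K) -> exists2 x,
  Complex 0 w *: x = Cmx (AK A B K) *m x + Cmx Bw *m u &
  Tinf A B Bw Qh Rh K w *m u = Cmx (out K) *m x.
Proof.
move=> Kh; exists (invmx ((Complex 0 w)%:M - Cmx (AK A B K)) *m (Cmx Bw *m u)).
  apply/eqP; rewrite -subr_eq0 opprD addrA -mul_scalar_mx -mulmxBl.
  by rewrite mulKVmx ?subrr //; exact: (hurwitz_unitmx Kh).
by rewrite /Tinf !mulmxA.
Qed.

(** Without an upper bound, the supremum in [hinf_norm] would fall back to 0 and control nothing. *)
Lemma opnorm_Tinf_bounded K : hurwitz (AK A B K) ->
  has_ubound (range (fun w => opnorm (Tinf A B Bw Qh Rh K w))).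
Proof.
move=> Kh; have [c c0 Hc] := resolvent_bounded Bw Kh.
have [d d0 Hd] := cmulmx_bounded (Cmx (out K)).
exists (Num.sqrt (d * c)) => _ [w _ <-]; apply: opnorm_le; first exact: sqrtr_ge0.
move=> u; have [x xu ->] := Tinf_response w u Kh.
rewrite sqr_sqrtr ?mulr_ge0 // (le_trans (Hd x)) // -mulrA.
by apply: ler_wpM2l; last exact: (Hc w).
Qed.

Lemma hinf_ge0 K : 0 <= hinf K.
Proof.
rewrite /hinf_norm; set S := [set _ | _ in _].
have [Ss|] := pselect (has_sup S); last by move=> /sup_out ->.
have [[y Sy] _] := Ss; have := sup_upper_bound Ss Sy; apply: le_trans.
by case: Sy => w _ <-; exact: opnorm_ge0.
Qed.

Lemma hinf_bound K w (x u : 'cV[C]_n) : hurwitz (AK A B K) ->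
  Complex 0 w *: x = Cmx (AK A B K) *m x + Cmx Bw *m u ->
  cvsq (Cmx (out K) *m x) <= hinf K ^+ 2 * cvsq u.
Proof.
move=> Kh xu; have [x' xu' Tx] := Tinf_response w u Kh.
have -> : x = x'.
  apply/eqP; rewrite -subr_eq0; apply/eqP.
  apply: (@hurwitz_kernel _ _ _ (Complex 0 w) _ Kh) => //=.
  by rewrite scalerBr xu xu' mulmxBr [_ *m x' + _]addrC addrKA.
rewrite -Tx (le_trans (opnorm_bound _ _)) // ler_wpM2r ?cvsq_ge0 //.
rewrite ler_pXn2r ?nnegrE ?opnorm_ge0 ?hinf_ge0 //.
apply: ub_le_sup; first exact: opnorm_Tinf_bounded.
by exists w.
Qed.

Lemma hinf_le K c : 0 <= c -> hurwitz (AK A B K) ->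
  (forall w (x u : 'cV[C]_n), Complex 0 w *: x = Cmx (AK A B K) *m x + Cmx Bw *m u ->
     cvsq (Cmx (out K) *m x) <= c ^+ 2 * cvsq u) -> hinf K <= c.
Proof.
move=> c0 Kh Hc; apply: ge_sup; first by exists (opnorm (Tinf A B Bw Qh Rh K 0)), 0.
move=> _ [w _ <-]; apply: opnorm_le => // u.
by have [x xu ->] := Tinf_response w u Kh; exact: (Hc w).
Qed.

Lemma exists_dissipative K c : hurwitz (AK A B K) -> hinf K ^+ 2 < c ->
  exists2 P, pd P & dissipative K P c.
Proof.
move=> Kh Kc; apply: (bounded_real Kh _ Kc).
  exact: le_lt_trans (sqr_ge0 _) Kc.
by move=> w x u; exact: hinf_bound.
Qed.

Hypothesis Qh_inj : forall x : 'cV[R]_n, Qh *m x = 0 -> x = 0.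

Lemma cvsq_out_eq0 K (x : 'cV[C]_n) : cvsq (Cmx (out K) *m x) <= 0 -> x = 0.
Proof.
move=> H; have : cvsq (Cmx (out K) *m x) == 0 by rewrite eq_le H cvsq_ge0.
rewrite cvsq_eq0 => /eqP E.
have := congr1 (@remx _ _ _) E; have := congr1 (@immx _ _ _) E.
rewrite remx_CmxM immx_CmxM !mul_col_mx remx0 immx0 => /eqP.
rewrite col_mx_eq0 => /andP[/eqP/Qh_inj i0 _] /eqP.
rewrite col_mx_eq0 => /andP[/eqP/Qh_inj r0 _].
by apply: parts_inj; rewrite ?r0 ?i0 ?remx0 ?immx0.
Qed.

(** For u = 0, an eigenvector with Re s >= 0 has zero output, hence is 0 because [Qh] is injective.
    The norm bound is the case of imaginary s. *)
Lemma rhp_stable K c : 0 <= c ->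
  (forall (s : C) (x u : 'cV[C]_n), 0 <= complex.Re s ->
     s *: x = Cmx (AK A B K) *m x + Cmx Bw *m u ->
     cvsq (Cmx (out K) *m x) <= c ^+ 2 * cvsq u) ->
  hurwitz (AK A B K) /\ hinf K <= c.
Proof.
move=> c0 H; have Kh : hurwitz (AK A B K).
  apply: hurwitzP => s x s0 Ax; apply: (@cvsq_out_eq0 K).
  have := H s x 0 s0; rewrite mulmx0 addr0 Ax => /(_ erefl).
  by rewrite (eqP (_ : cvsq 0 == 0)) ?cvsq_eq0 // mulr0.
by split=> //; apply: hinf_le => // w x u; apply: H.
Qed.

Lemma dissipative_stable K P c : 0 <= c -> pd P -> dissipative K P (c ^+ 2) ->
  hurwitz (AK A B K) /\ hinf K <= c.
Proof.
move=> c0 /pdE[Ps Pp] KP; apply: rhp_stable => // s x u s0 xu.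
apply: (dissipation_rhp _ KP s0 xu); apply/psdE; split=> // v.
by have [->|/Pp/ltW//] := eqVneq v 0; rewrite dot0l.
Qed.

Lemma pd_psd k (P : 'M[R]_k) : pd P -> psd P.
Proof.
move=> /pdE[Ps Pp]; apply/psdE; split=> // v.
by have [->|/Pp/ltW//] := eqVneq v 0; rewrite dot0l.
Qed.

Lemma pd_unitmx k (P : 'M[R]_k) : pd P -> P \in unitmx.
Proof.
move=> /pdE[Ps Pp]; rewrite unitmxE unitfE; apply/det0P => -[v v0 vP].
have /Pp : v^T != 0 by rewrite trmx_eq0.
by rewrite -[P *m _]trmxK trmx_mul trmxK Ps vP trmx0 dot0r ltxx.
Qed.

Lemma pd_invmx k (P : 'M[R]_k) : pd P -> pd (invmx P).
Proof.
move=> Pd; have /pdE[Ps Pp] := Pd; have Pu := pd_unitmx Pd; apply/pdE; split.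
  by rewrite trmx_inv Ps.
move=> v v0; rewrite -{1}[v](mulKVmx Pu) dotC.
by apply: Pp; apply: contra_neq v0 => H; rewrite -[v](mulKVmx Pu) H mulmx0.
Qed.

(** The best disturbance for given x yields |b|^2 <= -4c x^T P A_K x with b = Bw^T P x. As |P x| is
    bounded by a multiple of |b|, Cauchy-Schwarz bounds |P x| by |x| with a constant free of [P]. *)
Lemma dissipative_bound K c : Bw \in unitmx -> 0 < c ->
  exists2 L, 0 < L & forall P, pd P -> dissipative K P c ->
    forall x, dot x (P *m x) <= L * dot x x.
Proof.
move=> Bwu c0.
have [k k0 Hk] := mulmx_bounded (invmx Bw^T).
have [f f0 Hf] := mulmx_bounded (AK A B K).
(* Chosen so that L > 0 and L^2 >= (4ck)^2 f, without square roots. *)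
pose L := 4 * c * (k + 1) * (f + 1).
have L0 : 0 < L by rewrite /L !mulr_gt0 ?ltr_wpDl.
exists L => // P Pd KP x; have /pdE[Ps Pp] := Pd.
pose y := P *m x; pose b := Bw^T *m y.
have yb : dot y y <= k * dot b b.
  by have := Hk b; rewrite /b mulKmx // unitmx_tr.
have bA : dot b b <= - (4 * c) * dot y (AK A B K *m x).
  (* u = b/(2c) maximises b^T u - c |u|^2. *)
  have := KP x ((2 * c)^-1 *: b); have := dot_ge0 (out K *m x).
  rewrite dot_sym // (dotC (_ + _)) dotDr -scalemxAr !(dotZl, dotZr) -/y.
  have -> : dot y (Bw *m b) = dot b b by rewrite /b dot_mulmxl trmxK.
  move: (dot _ _) (dot b b) (dot y _) => o q r o0.
  have -> : c * ((2 * c)^-1 * ((2 * c)^-1 * q)) = q / (4 * c).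
    by field; rewrite gt_eqF.
  have -> : (2 * c)^-1 * q = 2 * (q / (4 * c)) by field; rewrite gt_eqF.
  move=> H; have : q / (4 * c) <= - r by lra.
  by rewrite ler_pdivrMr ?mulr_gt0 //; lra.
have CS1 := cauchy_schwarz y (AK A B K *m x).
have CS2 := cauchy_schwarz x y.
have HA := Hf x; have xx0 := dot_ge0 x; have yy0 := dot_ge0 y.
have AA0 := dot_ge0 (AK A B K *m x).
move: yb bA CS1 CS2 HA xx0 yy0 AA0; rewrite -/y.
move: (dot y _) (dot (AK A B K *m x) _) (dot b b) (dot y y) (dot x y) (dot x x).
move=> yA AA bb yy xy xx yb bA CS1 CS2 HA xx0 yy0 AA0.
pose g := 4 * c * k; have g0 : 0 <= g by rewrite !mulr_ge0 // ltW.
have yg : yy <= g * - yA.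
  by rewrite (le_trans yb) // /g (mulrC (4 * c)) -mulrA ler_wpM2l //; lra.
have yy_le : yy <= g ^+ 2 * (f * xx).
  have [->|yyn0] := eqVneq yy 0; first exact: mulr_ge0 (sqr_ge0 _) (mulr_ge0 f0 xx0).
  have yy1 : 0 < yy by rewrite lt_def yyn0.
  rewrite -(ler_pM2l yy1).
  have : yy * yy <= g ^+ 2 * yA ^+ 2.
    by rewrite -(sqrrN yA) -exprMn -expr2 ler_pXn2r // ?nnegrE // (le_trans yy0).
  move=> /le_trans; apply; rewrite [leRHS]mulrCA ler_wpM2l ?sqr_ge0 //.
  by rewrite (le_trans CS1) // ler_wpM2l.
have Lx0 : 0 <= L * xx by rewrite mulr_ge0 // ltW.
have [xy0|/ltW xy0] := leP xy 0; first exact: le_trans xy0 Lx0.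
rewrite -(@ler_pXn2r _ 2) ?nnegrE // (le_trans CS2) //.
apply: le_trans (_ : xx * (g ^+ 2 * (f * xx)) <= _); first by rewrite ler_wpM2l.
have -> : xx * (g ^+ 2 * (f * xx)) = (g ^+ 2 * f) * xx ^+ 2 by ring.
rewrite [leRHS]exprMn ler_wpM2r ?sqr_ge0 //.
have -> : L = (4 * c * (k + 1)) * (f + 1) by [].
rewrite [leRHS]exprMn; apply: ler_pM; rewrite ?sqr_ge0 //; last by nra.
by rewrite ler_pXn2r ?nnegrE /g //; nra.
Qed.

(* The convex combination is taken in the variables [X = P^-1], [Y = K X]. *)
Lemma dissipative_convex K0 K1 P0 P1 c0 c1 e : 0 <= e <= 1 ->
  pd P0 -> pd P1 -> dissipative K0 P0 c0 -> dissipative K1 P1 c1 ->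
  let X := (1 - e) *: invmx P0 + e *: invmx P1 in
  X \in unitmx ->
  dissipative (((1 - e) *: (K0 *m invmx P0) + e *: (K1 *m invmx P1)) *m invmx X)
    (invmx X) ((1 - e) * c0 + e * c1).
Proof.
move=> e01 P0d P1d KP0 KP1 X Xu; set K := _ *m invmx X => x u.
have /andP[e0 e1] := e01.
(* Both P0 x0 and P1 x1 equal [xi], so the two inequalities share one multiplier and average
   linearly; the output terms average by convexity of the square. *)
pose xi := invmx X *m x; pose x0 := invmx P0 *m xi; pose x1 := invmx P1 *m xi.
have xE : x = (1 - e) *: x0 + e *: x1.
  by rewrite /x0 /x1 !scalemxAl -mulmxDl mulKVmx.
have KxE : K *m x = (1 - e) *: (K0 *m x0) + e *: (K1 *m x1).
  by rewrite /K -mulmxA mulmxDl -!scalemxAl -!mulmxA.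
clearbody K.
have AxE : AK A B K *m x + Bw *m u = (1 - e) *: (AK A B K0 *m x0 + Bw *m u) +
    e *: (AK A B K1 *m x1 + Bw *m u).
  rewrite /AK !mulmxDl -!mulmxA KxE {1}xE !mulmxDr -!scalemxAr.
  move: (A *m x0) (A *m x1) (B *m _) (B *m _) (Bw *m u) => a0 a1 b0 b1 d.
  by apply/colP => i; rewrite !mxE; ring.
have outE : out K *m x = (1 - e) *: (out K0 *m x0) + e *: (out K1 *m x1).
  rewrite !mul_col_mx !scale_col_mx add_col_mx -!(mulmxA Rh) KxE {1}xE.
  by rewrite !mulmxDr -!scalemxAr.
have dotE0 (P : 'M[R]_n) v w : pd P -> dot (invmx P *m v) (P *m w) = dot v w.
  move=> Pd; have /pdE[Ps _] := Pd.
  by rewrite dotC dot_mulmxl Ps mulKVmx ?pd_unitmx // dotC.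
have := KP0 x0 u; have := KP1 x1 u; rewrite /x0 /x1 !dotE0 // -/x0 -/x1 => H1 H0.
have -> : dot x (invmx X *m (AK A B K *m x + Bw *m u)) =
    dot xi (AK A B K *m x + Bw *m u).
  have Xs : (invmx X)^T = invmx X.
    have /pdE[s0 _] := pd_invmx P0d; have /pdE[s1 _] := pd_invmx P1d.
    by rewrite trmx_inv /X linearD /= !linearZ /= s0 s1.
  by rewrite /xi dot_mulmxl Xs.
rewrite AxE outE [dot xi _]dotDr !(dotZr _ _ xi).
have := dot_convex (out K0 *m x0) (out K1 *m x1) e01.
have e1' : 0 <= 1 - e by rewrite subr_ge0.
have := ler_wpM2l e1' H0; have := ler_wpM2l e0 H1; lra.
Qed.

End Closure.

(** * The closure *)

Section Density.
Variables (R : realType) (n m : nat) (A : 'M[R]_n) (B : 'M[R]_(n, m)).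
Variables (Bw Qh : 'M[R]_n) (Rh : 'M[R]_m).
Implicit Types (K : 'M[R]_(m, n)) (P : 'M[R]_n).
Local Notation C := R[i].
Local Notation hinf := (hinf_norm A B Bw Qh Rh).
Local Notation out K := (col_mx Qh (Rh *m K)).
Local Notation dissipative := (dissipative A B Bw Qh Rh).
Hypothesis Qh_inj : forall x : 'cV[R]_n, Qh *m x = 0 -> x = 0.
Hypothesis Bw_unit : Bw \in unitmx.

Lemma ler_sqr_ge0 (x y : R) : 0 <= x -> x <= y -> x ^+ 2 <= y ^+ 2.
Proof. by move=> x0 xy; rewrite ler_pXn2r ?nnegrE // (le_trans x0). Qed.

Lemma ltr_sqr_ge0 (x y : R) : 0 <= x -> x < y -> x ^+ 2 < y ^+ 2.
Proof. by move=> x0 xy; rewrite ltr_pXn2r ?nnegrE // (le_trans x0) // ltW. Qed.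

Lemma pd_convex (X0 X1 : 'M[R]_n) e : 0 <= e <= 1 -> pd X0 -> pd X1 ->
  pd ((1 - e) *: X0 + e *: X1).
Proof.
move=> /andP[e0 e1] /pdE[s0 p0] /pdE[s1 p1]; apply/pdE; split.
  by rewrite linearD /= !linearZ /= s0 s1.
move=> v v0; rewrite mulmxDl -!scalemxAl dotDr !dotZr.
have e1' : 0 <= 1 - e by rewrite subr_ge0.
have := p0 _ v0; have := p1 _ v0; move: (dot v _) (dot v _) => a b b0 a0.
have := mulr_ge0 e0 (ltW b0); have := mulr_ge0 e1' (ltW a0).
have [->|en0] := eqVneq e 0; first lra.
have : 0 < e * b by rewrite mulr_gt0 // lt_def en0.
lra.
Qed.

(** For y = X^-1 x, y^T x = y^T X y >= y^T P^-1 y / 2 >= |y|^2 / (2L), the last step by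
    Cauchy-Schwarz for [P]. The constant does not involve [P0] or [e]. *)
Lemma invmx_convex_bound (P P0 X : 'M[R]_n) L e x : 0 < L -> 0 <= e <= 2^-1 ->
  pd P -> pd P0 -> (forall y, dot y (P *m y) <= L * dot y y) ->
  X = (1 - e) *: invmx P + e *: invmx P0 ->
  dot (invmx X *m x) (invmx X *m x) <= 4 * L ^+ 2 * dot x x.
Proof.
move=> L0 /andP[e0 e1] Pd P0d PL XE; set y := invmx X *m x.
have e01 : 0 <= e <= 1 by apply/andP; split; lra.
have Xu : X \in unitmx by rewrite XE; apply/pd_unitmx/pd_convex => //; exact: pd_invmx.
have xE : x = X *m y by rewrite /y mulKVmx.
have := psd_cauchy_schwarz y (invmx P *m y) (pd_psd Pd).
rewrite mulKVmx ?pd_unitmx // (dotC (invmx P *m y)).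
have /psdE[_ /(_ y) P0y] := pd_psd (pd_invmx P0d).
have := PL y; have : dot y x = (1 - e) * dot y (invmx P *m y) + e * dot y (invmx P0 *m y).
  by rewrite xE {1}XE mulmxDl -!scalemxAl dotDr !dotZr.
have := cauchy_schwarz y x; have := dot_ge0 y; have := dot_ge0 x.
have /psdE[_ /(_ y)] := pd_psd (pd_invmx Pd).
move: P0y; move: (dot y (invmx P0 *m y)) (dot y (invmx P *m y)) (dot y (P *m y)).
move: (dot y x) (dot x x) (dot y y) => yx xx yy p0 s t p00 s0 xx0 yy0 CS yxE tL st.
have [->|yyn0] := eqVneq yy 0; first by apply: mulr_ge0 => //; apply: mulr_ge0 (ler0n _ _) (sqr_ge0 _).
have yy1 : 0 < yy by rewrite lt_def yyn0.
have yLs : yy <= L * s.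
  rewrite -(ler_pM2l yy1) -expr2 (le_trans st) // mulrA [yy * L]mulrC.
  by rewrite ler_wpM2r.
have yLx : yy <= 2 * L * yx.
  have e0p : 0 <= e * p0 by exact: mulr_ge0.
  have e1' : 0 <= 2^-1 - e by rewrite subr_ge0.
  have : s <= 2 * yx by have := mulr_ge0 e1' s0; rewrite yxE; lra.
  by move=> H; have := ler_wpM2l (ltW L0) H; lra.
rewrite -(ler_pM2l yy1) -expr2.
have : yy ^+ 2 <= (2 * L * yx) ^+ 2 by rewrite ler_pXn2r ?nnegrE // (le_trans yy0).
move=> /le_trans; apply; rewrite exprMn.
have -> : yy * (4 * L ^+ 2 * xx) = (2 * L) ^+ 2 * (yy * xx) by ring.
by rewrite ler_wpM2l ?sqr_ge0.
Qed.

Lemma strict_dense K K0 b r : 0 < b -> 0 < r ->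
  hurwitz (AK A B K) -> hinf K <= b -> hurwitz (AK A B K0) -> hinf K0 < b ->
  exists K', [/\ hurwitz (AK A B K'), hinf K' < b &
    forall i j, `|K i j - K' i j| < r].
Proof.
move=> b0 r0 Kh Kb K0h K0b.
have b2 : 0 < b ^+ 2 by exact: exprn_gt0.
have dissK c : b ^+ 2 < c -> exists2 P, pd P & dissipative K P c.
  move=> bc; apply: (exists_dissipative Kh); apply: le_lt_trans bc.
  exact: ler_sqr_ge0 (hinf_ge0 _ _ _ _ _ _) Kb.
have [c0 [c00 c0b [P0 P0d KP0]]] : exists c0,
    [/\ 0 < c0, c0 < b ^+ 2 & exists2 P, pd P & dissipative K0 P c0].
  have h0b : hinf K0 ^+ 2 < b ^+ 2.
    exact: ltr_sqr_ge0 (hinf_ge0 _ _ _ _ _ _) K0b.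
  have h0 := sqr_ge0 (hinf K0).
  exists (((hinf K0) ^+ 2 + b ^+ 2) / 2); split.
  - apply: divr_gt0; [exact: ltr_wpDl h0 b2|exact: ltr0Sn].
  - exact: (midf_lt h0b).2.
  - exact: exists_dissipative K0h (midf_lt h0b).1.
move=> {Kh Kb K0h K0b}.
(* The level 2b^2 exceeds every level [c] used below, so [L] is fixed before [e] and [P] are
   chosen. *)
have [|L L0 HL] := @dissipative_bound _ _ _ A B Bw Qh Rh K (2 * b ^+ 2) Bw_unit.
  by rewrite mulr_gt0.
have [M M0 HM] := mulmx_bounded ((K0 - K) *m invmx P0).
pose D := 2 * L * (M + 1).
have D0 : 0 < D by rewrite !mulr_gt0 // ltr_wpDl.
(* This gives both e <= 1/2 and e D < r. *)
pose e := r / (2 * r + D).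
have e0 : 0 < e by rewrite divr_gt0 // addr_gt0 // mulr_gt0.
have eE : e * (2 * r + D) = r by rewrite divfK // gt_eqF // addr_gt0 // mulr_gt0.
have e1 : e <= 2^-1.
  by rewrite /e ler_pdivrMr ?addr_gt0 ?mulr_gt0 //; lra.
have eD : e * D < r by have := mulr_gt0 e0 r0; lra.
have e01 : 0 <= e <= 1 by apply/andP; split; lra.
have ec : 0 < e * (b ^+ 2 - c0) by rewrite mulr_gt0 // subr_gt0.
(* The combined level (1 - e) c + e c0 is then b^2 - e (1 + e) (b^2 - c0) / 2, below b^2. *)
pose c := b ^+ 2 + e * (b ^+ 2 - c0) / 2.
have [|P Pd KP] := dissK c; first by rewrite /c; lra.
have cb : c <= 2 * b ^+ 2.
  have : e * (b ^+ 2 - c0) <= 1 * (b ^+ 2 - c0) by rewrite ler_wpM2r //; lra.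
  by rewrite /c; lra.
have PL : forall x, dot x (P *m x) <= L * dot x x.
  apply: HL => // x u; apply: (le_trans (KP x u)).
  by rewrite ler_wpM2r ?dot_ge0.
pose X := (1 - e) *: invmx P + e *: invmx P0.
have Xd : pd X by apply: pd_convex => //; exact: pd_invmx.
have := dissipative_convex e01 Pd P0d KP KP0 (pd_unitmx Xd); rewrite -/X /=.
set K' := _ *m invmx X; set cc := _ + e * c0 => KP'.
have eec : 0 < e * (e * (b ^+ 2 - c0)) by exact: mulr_gt0.
have cc0 : 0 <= cc.
  have e1' : 0 <= 1 - e by lra.
  have bc : 0 <= c by rewrite /c; lra.
  exact: addr_ge0 (mulr_ge0 e1' bc) (mulr_ge0 (ltW e0) (ltW c00)).
have ccb : cc < b ^+ 2 by rewrite /cc /c; lra.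
exists K'.
have [||K'h K'b] := @dissipative_stable _ _ _ A B Bw Qh Rh Qh_inj K' _ (Num.sqrt cc) _ (pd_invmx Xd).
- exact: sqrtr_ge0.
- by rewrite sqr_sqrtr.
split=> [||i j]; first exact: K'h.
  apply: (le_lt_trans K'b); rewrite -[b]ger0_norm ?ltW // -sqrtr_sqr.
  by rewrite ltr_sqrt.
pose x : 'cV[R]_n := delta_mx j 0; pose y := invmx X *m x.
have xx : dot x x = 1 by rewrite /dot trmx_delta mul_delta_mx mxE !eqxx.
have yL := invmx_convex_bound x L0 (introT andP (conj (ltW e0) e1)) Pd P0d PL
  (erefl X).
rewrite xx mulr1 -/y in yL.
(* The contributions of P^-1 to K' X and K X coincide, so the difference carries a factor e. *)
have dK : (K' - K) *m x = e *: ((K0 - K) *m invmx P0 *m y).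
  have K'x : K' *m x =
      ((1 - e) *: (K *m invmx P) + e *: (K0 *m invmx P0)) *m y.
    by rewrite /K' -mulmxA.
  have Kx : K *m x = K *m (X *m y) by rewrite /y mulKVmx // pd_unitmx.
  rewrite mulmxBl K'x Kx /X !mulmxDl mulmxDr -!scalemxAl -!scalemxAr -!mulmxA.
  rewrite !mulNmx.
  move: (K *m _) (K0 *m _) (K *m _) => a0 a1 a2.
  by apply/colP => l; rewrite !mxE; ring.
have Kij : K' i j - K i j = ((K' - K) *m x) i 0 by rewrite /x -colE !mxE.
have le_dot : (K' i j - K i j) ^+ 2 <= dot ((K' - K) *m x) ((K' - K) *m x).
  rewrite Kij dotE (bigD1 i) //= -expr2 lerDl.
  by apply: sumr_ge0 => l _; rewrite -expr2 sqr_ge0.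
rewrite distrC -(@ltr_pXn2r _ 2) ?nnegrE ?normr_ge0 ?ltW // real_normK ?num_real //.
apply: (le_lt_trans le_dot); rewrite dK dotZl dotZr mulrA.
have H1 : dot ((K0 - K) *m invmx P0 *m y) ((K0 - K) *m invmx P0 *m y)
    <= M * (4 * L ^+ 2).
  exact: le_trans (HM y) (ler_wpM2l M0 yL).
have : (e * D) ^+ 2 < r ^+ 2.
  exact: ltr_sqr_ge0 (mulr_ge0 (ltW e0) (ltW D0)) eD.
apply: le_lt_trans; rewrite exprMn -expr2 ler_wpM2l ?sqr_ge0 // (le_trans H1) //.
have -> : D ^+ 2 = (M + 1) ^+ 2 * (4 * L ^+ 2) by rewrite /D; ring.
rewrite ler_wpM2r ?(mulr_ge0 (ler0n _ _)) ?sqr_ge0 //.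
by have := sqr_ge0 M; lra.
Qed.

Lemma dot_affine_continuous p (a : 'cV[R]_p) (M : 'M[R]_(p, m)) (x : 'cV[R]_n) :
  continuous (fun K => dot (a + M *m K *m x) (a + M *m K *m x)).
Proof.
have -> : (fun K => dot (a + M *m K *m x) (a + M *m K *m x)) =
    (fun K => \sum_i ((a + M *m K *m x) i 0) * ((a + M *m K *m x) i 0)).
  by apply/funext => K; rewrite dotE.
have /= := @continuous_sum R ('M[R]_(m, n) : topologicalType) 'I_p
  (fun i K => (a + M *m K *m x) i 0 * (a + M *m K *m x) i 0).
apply=> i K.
have lin : continuous (fun K => (M *m K *m x) i 0).
  apply: linear_mx_continuous => c K1 K2.
  by rewrite mulmxDr mulmxDl -scalemxAr -scalemxAl !mxE.
have aff : {for K, continuous (fun K => (a + M *m K *m x) i 0)}.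
  have -> : (fun K => (a + M *m K *m x) i 0) = (fun K => a i 0 + (M *m K *m x) i 0).
    by apply/funext => K'; rewrite mxE.
  by have := continuousD (@cst_continuous _ _ (a i 0) K) (lin K); exact.
by have := continuousM aff aff; exact.
Qed.

(** For fixed s, x, u the inequality in K' is a closed condition satisfied on the sublevel set; at
    K' = K it is the hypothesis of [rhp_stable]. *)
Lemma closure_Kbeta_stable b K : 0 < b -> closure (Kbeta A B Bw Qh Rh b) K ->
  hurwitz (AK A B K) /\ hinf K <= b.
Proof.
move=> b0 clK; apply: (rhp_stable Qh_inj) => [|s x u s0 xu]; first exact: ltW.
(* Then B (K' - K) x = Bw J (K' - K) x is a disturbance. *)
pose J := invmx Bw *m B.
pose q := dot (Qh *m remx x) (Qh *m remx x) + dot (Qh *m immx x) (Qh *m immx x).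
pose g y K' := dot (0 + Rh *m K' *m y) (0 + Rh *m K' *m y).
pose h v y K' := dot (v + J *m K *m y + (- J) *m K' *m y)
  (v + J *m K *m y + (- J) *m K' *m y).
pose f K' := b ^+ 2 * (h (remx u) (remx x) K' + h (immx u) (immx x) K') -
  (g (remx x) K' + g (immx x) K').
have fE K' : (q <= f K') = (cvsq (Cmx (out K') *m x) <=
    b ^+ 2 * cvsq (u - Cmx (J *m (K' - K)) *m x)).
  rewrite /f /cvsq !remx_CmxM !immx_CmxM !mul_col_mx !dot_col_mx.
  rewrite !remxD !immxD -!mulNmx.
  have -> : - Cmx (J *m (K' - K)) = Cmx (- (J *m (K' - K))).
    by apply/matrixP => i j; rewrite !mxE /=; congr Complex; rewrite oppr0.
  rewrite !remx_CmxM !immx_CmxM /g !add0r.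
  have hE v y : h v y K' = dot (v - (J *m (K' - K)) *m y) (v - (J *m (K' - K)) *m y).
    rewrite /h; congr (dot _ _); rewrite mulmxBr mulmxBl mulNmx mulNmx opprB;
    by rewrite -addrA.
  rewrite !hE !mulNmx /q lerBrDr; congr (_ <= _); ring.
have fc : continuous f.
  move=> K'.
  have gc y : {for K', continuous (g y)} by exact: dot_affine_continuous.
  have hc v y : {for K', continuous (h v y)} by exact: dot_affine_continuous.
  have := continuousB
    (continuousM (@cst_continuous _ _ (b ^+ 2) K')
       (continuousD (hc (remx u) (remx x)) (hc (immx u) (immx x))))
    (continuousD (gc (remx x)) (gc (immx x))).
  exact.
have fcl : closed [set K' | q <= f K'].
  by apply: (@preimage_closed _ _ f [set y : R | q <= y]) => [y _|];
    [exact: fc|exact: closed_ge].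
suff sub : Kbeta A B Bw Qh Rh b `<=` [set K' | q <= f K'].
  have : closure [set K' | q <= f K'] K by exact: (closureS sub).
  rewrite -(closure_id _).1 // /= fE subrr mulmx0 Cmx0 mul0mx subr0 //.
move=> K' [K'h K'b] /=; rewrite fE.
have [P Pd KP] := exists_dissipative K'h (ltr_sqr_ge0 (hinf_ge0 _ _ _ _ _ _) K'b).
(* It remains to check A_K x + Bw u = A_K' x + Bw (u - J (K' - K) x). *)
apply: (dissipation_rhp (pd_psd Pd) KP s0); rewrite xu.
rewrite mulmxBr mulmxA -CmxM /J !mulmxA mulmxV // mul1mx.
have -> : AK A B K' = AK A B K + B *m (K' - K).
  by rewrite /AK mulmxBr addrA addrAC addrK.
by rewrite CmxD mulmxDl addrACA [Cmx (B *m _) *m x + _]addrC addrA subrK.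
Qed.

End Density.

Theorem theorem1 (R : realType) (n m : nat)
  (A : 'M[R]_n) (B : 'M[R]_(n, m)) (Bw : 'M[R]_n)
  (Q2 Qinf : 'M[R]_n) (R2 Rinf : 'M[R]_m)
  (Q2h Qinfh : 'M[R]_n) (Rinfh : 'M[R]_m) (beta : R) :
  (* weights and their (psd) square roots *)
  is_sqrtm Q2h Q2 -> is_sqrtm Qinfh Qinf -> is_sqrtm Rinfh Rinf ->
  0 < beta ->
  (* Assumption 1 *)
  stabilizable A B -> detectable Q2h A ->
  beta_star A B Bw Qinfh Rinfh < beta ->
  (* Assumption 2 *)
  psd Q2 -> pd (Bw *m Bw^T) -> pd Qinf -> pd R2 -> pd Rinf ->
  closure (Kbeta A B Bw Qinfh Rinfh beta) =
    [set K | Kstab A B K /\ hinf_norm A B Bw Qinfh Rinfh K <= beta].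
Proof.
move=> _ [_ QQ] _ b0 [K1 K1h] _ bstar _ Wd Qd _ _.
have Bwu : Bw \in unitmx.
  by have := pd_unitmx Wd; rewrite unitmx_mul => /andP[].
have Qinj (x : 'cV[R]_n) : Qinfh *m x = 0 -> x = 0.
  move=> Qx; have := pd_unitmx Qd; rewrite -QQ unitmx_mul => /andP[Qu _].
  by rewrite -[x](mulKmx Qu) Qx mulmx0.
(* [beta] exceeds the infimum, taken over a set that stabilizability makes nonempty, so some [K0]
   lies strictly below [beta]. *)
have [_ [K0 K0h <-] K0b] : exists2 y,
    [set hinf_norm A B Bw Qinfh Rinfh K | K in Kstab A B] y & y < beta.
  by apply: inf_lt bstar; exists (hinf_norm A B Bw Qinfh Rinfh K1), K1.
apply/seteqP; split=> K /=; first exact: closure_Kbeta_stable.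
move=> [Kh Kb] N /nbhs_ballP[r /= r0 rN].
have [K' [K'h K'b K'r]] := strict_dense Qinj Bwu b0 r0 Kh Kb K0h K0b.
by exists K'; split=> //; apply: rN; split.
Qed.
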